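(* For every integers $k, p, t\ge 2$, there exists $\delta>0$ such that the following holds for all sufficiently large integers $n$. Let $a_1,\dots,a_p$ be positive integers with $1\le a_1\le \dots\le a_{p-1}\le t$ and $a_p\le \delta n$. If $a_1=1$, then $$r(K_p(a_1,\dots,a_p),B_{k,n})\le (p-1)(n-1)+k(p-1)(a_2-1)+1.$$ Moreover, equality holds if $a_2$ divides $n-1-k$ and $a_{p-1}\le a_p$.
   Context: For graphs $H_1,H_2$, the Ramsey number $r(H_1,H_2)$ is the smallest positive integer $N$ such that for every graph $G$ on $N$ vertices, either $G$ contains $H_1$ as a (not necessarily induced) subgraph or the complement $\overline{G}$ contains $H_2$ as a subgraph. $K_p(a_1,\dots,a_p)$ is the complete $p$-partite graph with parts of sizes $a_1,\dots,a_p$. $B_{k,n}$ is the book graph on $n$ vertices consisting of $n-k$ copies of $K_{k+1}$ all sharing a common $K_k$ (i.e. a clique on $k$ vertices together with $n-k$ further vertices, pairwise non-adjacent, each adjacent to all $k$ vertices of the clique). ''Sufficiently large'' may depend on $k,p,t$ and $\delta$. When $p=2$, the condition $1\le a_1\le\dots\le a_{p-1}\le t$ concerns only $a_1$. *)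

(* Defs.v *)
From mathcomp Require Import all_boot all_algebra.
From mathcomp Require Import boolp reals.

Set Implicit Arguments.
Unset Strict Implicit.
Unset Printing Implicit Defensive.

Record sgraph := SGraph {
  vertex :> finType;
  adj : rel vertex;
  adj_sym : symmetric adj;
  adj_irr : irreflexive adj
}.

Section Complement.
Variable G : sgraph.

Definition compl_adj : rel G := fun x y => (x != y) && ~~ adj x y.

Lemma compl_adj_sym : symmetric compl_adj.
Proof. by move=> x y; rewrite /compl_adj eq_sym adj_sym. Qed.

Lemma compl_adj_irr : irreflexive compl_adj.
Proof. by move=> x; rewrite /compl_adj eqxx. Qed.

Definition compl : sgraph := SGraph compl_adj_sym compl_adj_irr.
End Complement.

Definition has_subgraph (G H : sgraph) : Prop :=
  exists f : H -> G, injective f /\ (forall x y, adj x y -> adj (f x) (f y)).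

Section CompleteMultipartite.
Variables (p : nat) (a : 'I_p -> nat).

Definition multipartite_adj : rel {i : 'I_p & 'I_(a i)} :=
  fun x y => tag x != tag y.

Lemma multipartite_adj_sym : symmetric multipartite_adj.
Proof. by move=> x y; rewrite /multipartite_adj eq_sym. Qed.

Lemma multipartite_adj_irr : irreflexive multipartite_adj.
Proof. by move=> x; rewrite /multipartite_adj eqxx. Qed.

Definition complete_multipartite : sgraph :=
  SGraph multipartite_adj_sym multipartite_adj_irr.
End CompleteMultipartite.

(* The vertices 0, ..., k - 1 form the common clique K_k (assuming k <= n). *)
Section Book.
Variables k n : nat.

Definition book_adj : rel 'I_n :=
  fun x y => (x != y) && ((x < k) || (y < k)).

Lemma book_adj_sym : symmetric book_adj.
Proof. by move=> x y; rewrite /book_adj eq_sym orbC. Qed.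

Lemma book_adj_irr : irreflexive book_adj.
Proof. by move=> x; rewrite /book_adj eqxx. Qed.

Definition book : sgraph := SGraph book_adj_sym book_adj_irr.
End Book.

Definition ramsey_prop (H1 H2 : sgraph) (N : nat) : Prop :=
  forall G : sgraph, #|G| = N -> has_subgraph G H1 \/ has_subgraph (compl G) H2.

(* Ramsey's theorem, so that the Ramsey number is a total function. *)
Lemma ramsey_cliques (s t : nat) : exists N : nat,
  forall (T : finType) (e : rel T) (A : {set T}), symmetric e -> N <= #|A| ->
    (exists S : {set T}, #|S| = s /\ {in S &, forall x y, x != y -> e x y}) \/
    (exists S : {set T}, #|S| = t /\ {in S &, forall x y, x != y -> ~~ e x y}).
Proof.
elim: s t => [|s IHs] t.
  exists 0 => T e A _ _; left; exists set0; rewrite cards0; split=> //.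
  by move=> x y; rewrite inE.
elim: t => [|t [N2 IHt]].
  exists 0 => T e A _ _; right; exists set0; rewrite cards0; split=> //.
  by move=> x y; rewrite inE.
have [N1 IH1] := IHs t.+1.
exists (N1 + N2).+1 => T e A e_sym leNA.
have /card_gt0P[v vA] : 0 < #|A| by apply: leq_trans leNA.
pose nb := [set y | e v y].
have extend (S : {set T}) (r : rel T) : symmetric r -> v \notin S ->
    {in S, forall y, r v y} -> {in S &, forall x y, x != y -> r x y} ->
    {in v |: S &, forall x y, x != y -> r x y}.
  move=> r_sym vS rv rS x y /setU1P[->|xS] /setU1P[->|yS] //.
  - by rewrite eqxx.
  - by move=> _; apply: rv.
  - by move=> _; rewrite r_sym; apply: rv.
  - exact: rS.
have : N1 + N2 <= #|(A :\ v) :&: nb| + #|(A :\ v) :\: nb|.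
  by rewrite cardsID; move: leNA; rewrite (cardsD1 v A) vA.
have sub_ind (B : {set T}) s0 t0 N :
    (forall (T : finType) (e : rel T) (A : {set T}), symmetric e -> N <= #|A| ->
    (exists S : {set T}, #|S| = s0 /\ {in S &, forall x y, x != y -> e x y}) \/
    (exists S : {set T}, #|S| = t0 /\ {in S &, forall x y, x != y -> ~~ e x y}))
    -> N <= #|B| ->
    (exists S : {set T}, [/\ S \subset B, #|S| = s0 &
        {in S &, forall x y, x != y -> e x y}]) \/
    (exists S : {set T}, [/\ S \subset B, #|S| = t0 &
        {in S &, forall x y, x != y -> ~~ e x y}]).
  move=> IH leNB.
  pose e' (x y : {x : T | x \in B}) := e (val x) (val y).
  have lift (r : rel T) n (S : {set {x : T | x \in B}}) : #|S| = n ->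
      {in S &, forall x y, x != y -> r (val x) (val y)} ->
      exists S : {set T}, [/\ S \subset B, #|S| = n &
        {in S &, forall x y, x != y -> r x y}].
    move=> cS rS; exists (val @: S); split.
    - by apply/subsetP=> _ /imsetP[x _ ->]; apply: valP.
    - by rewrite card_imset //; apply: val_inj.
    - move=> _ _ /imsetP[x xS ->] /imsetP[y yS ->]; rewrite val_eqE.
      exact: rS.
  have [||[S [cS eS]]|[S [cS eS]]] := IH _ e' [set: {x : T | x \in B}].
  - by move=> x y; apply: e_sym.
  - by rewrite cardsT card_sig.
  - by left; apply: lift cS eS.
  - by right; apply: (lift (fun x y => ~~ e x y)) cS eS.
have [leN1 _|ltN1 leN12] := leqP N1 #|(A :\ v) :&: nb|.
  have [[S [SB cS eS]]|[S [_ cS eS]]] := sub_ind _ _ _ _ IH1 leN1; last first.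
    by right; exists S.
  have vS : v \notin S.
    by apply/negP=> /(subsetP SB); rewrite !inE eqxx.
  left; exists (v |: S); rewrite cardsU1 vS cS; split=> //.
  by apply: extend => // y /(subsetP SB); rewrite !inE => /andP[].
have leN2 : N2 <= #|(A :\ v) :\: nb|.
  by rewrite -(leq_add2l N1) (leq_trans leN12) // leq_add2r ltnW.
have [[S [_ cS eS]]|[S [SB cS eS]]] := sub_ind _ _ _ _ IHt leN2.
  by left; exists S.
have vS : v \notin S.
  by apply/negP=> /(subsetP SB); rewrite !inE eqxx andbF.
right; exists (v |: S); rewrite cardsU1 vS cS; split=> //.
apply: (extend _ (fun x y => ~~ e x y)) => //.
  by move=> x y; rewrite e_sym.
by move=> y /(subsetP SB); rewrite !inE => /andP[].
Qed.

Lemma has_subgraph_clique (G H : sgraph) (S : {set G}) : #|S| = #|H| ->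
  {in S &, forall x y, x != y -> adj x y} -> has_subgraph G H.
Proof.
move=> cS eS.
have f_inj : injective (fun x : H => enum_val (cast_ord (esym cS) (enum_rank x))).
  by move=> x y /enum_val_inj /cast_ord_inj /enum_rank_inj.
exists (fun x => enum_val (cast_ord (esym cS) (enum_rank x))); split=> // x y xy.
apply: eS; rewrite ?enum_valP // (inj_eq f_inj).
by apply: contraTneq xy => ->; rewrite adj_irr.
Qed.

Lemma ramsey_exists (H1 H2 : sgraph) :
  exists N, (0 < N) && `[< ramsey_prop H1 H2 N >].
Proof.
have [N HN] := ramsey_cliques #|H1| #|H2|.
exists N.+1; apply/asboolP => G cG.
have [|[S [cS eS]]|[S [cS eS]]] := HN _ _ [set: G] (@adj_sym G).
- by rewrite cardsT cG leqnSn.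
- by left; apply: has_subgraph_clique eS.
- right; apply: (@has_subgraph_clique (compl G) H2 S) => // x y xS yS xy.
  by rewrite /= /compl_adj xy eS.
Qed.

Definition ramsey (H1 H2 : sgraph) : nat := ex_minn (ramsey_exists H1 H2).

(* Main.v *)
Require Import Defs.
From mathcomp Require Import all_boot all_order all_algebra.
From mathcomp Require Import boolp reals.
From mathcomp Require Import zify.

Set Implicit Arguments.
Unset Strict Implicit.
Unset Printing Implicit Defensive.

(* Write q = p - 1 and suppose that G, on q(n-1) + kq(a_2-1) + 1 vertices, has
   no K_p(1, a_2, ..., a_p) while every independent k-set has fewer than n common
   non-neighbours.  For an independent set V and a vertex v, the weight of v is
   the number of k-subsets of V without a neighbour of v; summed over v, these
   weights are at most C(|V|, k)(n - 1).
   First, G contains q independent sets V_i of a large constant size, completely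
   joined to each other.  Vertices with many neighbours in every V_i are few (by
   pigeonhole they would produce a K_p), so the q weights of most vertices sum to
   almost 1 or more; as there are about q n vertices, most vertices miss almost
   all of exactly one V_i and almost nothing of the others.  Replacing one V_i by
   other independent sets with the same property gives sets A_i of linear size
   that are almost completely joined.  A star K_{1,a_2} in A_i would extend to a
   K_p, so A_i may be shrunk to an independent set, all of the same size.
   Every vertex v has few neighbours in some A_i, and is put in class i.  If v also
   misses a fixed proportion of another A_j, its total weight is at least C(|A_i|, k);
   the other vertices of class i send at most a_2 - 1 edges to each vertex of A_i.
   Summing the weights over all v contradicts the bound above.
   For the lower bound take q completely joined blocks, each a disjoint union of
   copies of K_{a_2}. *)

Lemma card_bigcup_le (T I : finType) (P : pred I) (F : I -> {set T}) :
  #|\bigcup_(i | P i) F i| <= \sum_(i | P i) #|F i|.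
Proof.
elim/big_ind2: _ => [|n A m B nA mB|//]; first by rewrite cards0.
by apply: leq_trans (leq_add nA mB); rewrite cardsU leq_subr.
Qed.

(** * Counting in graphs *)

Section Graph.
Variable G : sgraph.
Implicit Types (u v x y : G) (A B D I V W X Y : {set G}).

Definition nbr v : {set G} := [set u | adj v u].
Definition indep I := [forall x in I, forall y in I, ~~ adj x y].
Definition joined A B := [forall x in A, forall y in B, adj x y].
Definition nonnbr I : {set G} := [set v | I \subset ~: nbr v].

Lemma in_nbr u v : (u \in nbr v) = adj v u. Proof. by rewrite inE. Qed.

Lemma indepP I : reflect {in I &, forall x y, ~~ adj x y} (indep I).
Proof.
apply: (iffP forall_inP) => h x.
  by move=> y xI yI; have /forall_inP := h x xI; apply.
by move=> xI; apply/forall_inP => y yI; apply: h.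
Qed.

Lemma joinedP A B :
  reflect (forall x y, x \in A -> y \in B -> adj x y) (joined A B).
Proof.
apply: (iffP forall_inP) => h x.
  by move=> y xI yI; have /forall_inP := h x xI; apply.
by move=> xI; apply/forall_inP => y yI; apply: h.
Qed.

Lemma indepS I A : I \subset A -> indep A -> indep I.
Proof.
move=> /subsetP IA /indepP h; apply/indepP => x y xI yI.
by apply: h; apply: IA.
Qed.

Lemma joinedS A B A' B' :
  A' \subset A -> B' \subset B -> joined A B -> joined A' B'.
Proof.
move=> /subsetP As /subsetP Bs /joinedP h; apply/joinedP => x y xA yB.
by apply: h; [apply: As | apply: Bs].
Qed.

Lemma joined_sym A B : joined A B = joined B A.
Proof.
by apply/joinedP/joinedP => h x y xA yB; rewrite adj_sym; apply: h.
Qed.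

Lemma subset_card (n : nat) A : n <= #|A| -> exists2 B : {set G}, B \subset A & #|B| = n.
Proof.
move=> nA; have nE : n <= size (enum A) by rewrite -cardE.
exists [set x | x \in take n (enum A)].
  by apply/subsetP => x; rewrite inE => /mem_take; rewrite mem_enum.
rewrite cardsE -[RHS](size_takel nE); apply/card_uniqP.
by rewrite take_uniq // enum_uniq.
Qed.

(** Pigeonhole over the [2 ^ #|D|] possible traces; [D0] is the most frequent one. *)
Lemma card_trace X D :
  exists D0, #|X| <= 2 ^ #|D| * #|[set x in X | nbr x :&: D == D0]|.
Proof.
pose c D0 := #|[set x in X | nbr x :&: D == D0]|.
have [D0 _ maxD0] := @arg_maxnP _ set0 xpredT c isT.
exists D0; rewrite -card_powerset.
have -> : #|X| = \sum_(D1 in powerset D) c D1.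
  rewrite -sum1_card (partition_big (fun x => nbr x :&: D) (mem (powerset D))).
    apply: eq_bigr => D1 _; rewrite /c -sum1_card.
    by apply: eq_bigl => x; rewrite !inE.
  by move=> x _; rewrite /= powersetE subsetIr.
rewrite -sum_nat_const; apply: leq_sum => D1 _; exact: maxD0.
Qed.

Lemma sum_nbrC X Y :
  \sum_(x in X) #|nbr x :&: Y| = \sum_(y in Y) #|nbr y :&: X|.
Proof.
transitivity (\sum_(x in X) \sum_(y in Y) adj x y : nat).
  apply: eq_bigr => x _; rewrite -sum1_card big_mkcond [RHS]big_mkcond /=.
  by apply: eq_bigr => y _; rewrite !inE; case: (adj x y); case: (y \in Y).
rewrite exchange_big /=; apply: eq_bigr => y _.
rewrite -sum1_card big_mkcond [RHS]big_mkcond /=.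
by apply: eq_bigr => x _; rewrite !inE adj_sym; case: (adj y x); case: (x \in X).
Qed.

Lemma sum_nonnbrC X Y :
  \sum_(x in X) #|Y :\: nbr x| = \sum_(y in Y) #|X :\: nbr y|.
Proof.
transitivity (\sum_(x in X) \sum_(y in Y) ~~ adj x y : nat).
  apply: eq_bigr => x _; rewrite -sum1_card big_mkcond [RHS]big_mkcond /=.
  by apply: eq_bigr => y _; rewrite !inE; case: (adj x y); case: (y \in Y).
rewrite exchange_big /=; apply: eq_bigr => y _.
rewrite -sum1_card big_mkcond [RHS]big_mkcond /=.
by apply: eq_bigr => x _; rewrite !inE adj_sym; case: (adj y x); case: (x \in X).
Qed.

Definition common A : {set G} := [set v | A \subset nbr v].

Lemma commonP A v : reflect (forall u, u \in A -> adj u v) (v \in common A).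
Proof.
rewrite inE; apply: (iffP subsetP) => h u uA; first by rewrite adj_sym -in_nbr h.
by rewrite in_nbr adj_sym h.
Qed.

Lemma card_common A Y :
  #|Y| <= #|Y :&: common A| + \sum_(u in A) #|Y :\: nbr u|.
Proof.
rewrite -(cardsID (common A) Y) leq_add2l.
apply: leq_trans (card_bigcup_le _ _); apply/subset_leq_card/subsetP => v.
rewrite !inE => /andP[/subsetPn[u uA uv] vY].
by apply/bigcupP; exists u; rewrite // !inE vY adj_sym; move: uv; rewrite inE => ->.
Qed.

(** A maximal independent subset [I] of [Y] dominates [Y], and each of its closed neighbourhoods
    inside [Y] has at most [d] vertices. *)
Lemma indep_greedy d Y : (forall x, x \in Y -> #|nbr x :&: Y| < d) ->
  exists I : {set G}, [/\ I \subset Y, indep I & #|Y| <= d * #|I|].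
Proof.
move=> degY.
have [|I /maxsetP[/andP[IY iI] maxI]] :=
    @ex_maxset _ (fun I => (I \subset Y) && indep I).
  exists set0; rewrite sub0set; apply/indepP => x y; by rewrite inE.
exists I; split=> //.
have sub : Y \subset \bigcup_(x in I) (x |: (nbr x :&: Y)).
  apply/subsetP => y yY; apply/bigcupP.
  have [yI|yI] := boolP (y \in I); first by exists y; rewrite // !inE eqxx.
  have [/existsP[x /andP[xI xy]]|h] := boolP [exists x in I, adj x y].
    by exists x; rewrite // !inE xy yY orbT.
  have noI x : x \in I -> adj x y = false.
    move=> xI; apply/negP => xy; case/negP: h; apply/existsP; exists x.
    by rewrite xI.
  have E : y |: I = I.
    apply: maxI (subsetUr _ _); rewrite subUset sub1set yY IY /=.
    apply/indepP => a b /setU1P[->|aI] /setU1P[->|bI].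
    - by rewrite adj_irr.
    - by rewrite adj_sym noI.
    - by rewrite noI.
    - by move/indepP: iI; apply.
  by case/negP: yI; rewrite -E setU11.
apply: (leq_trans (subset_leq_card sub)).
apply: (leq_trans (card_bigcup_le _ _)).
rewrite mulnC -sum_nat_const; apply: leq_sum => x xI.
rewrite cardsU1 !inE adj_irr /= add1n; apply: degY.
exact: (subsetP IY).
Qed.

Lemma sum_bin_nonnbr k V (R : {set G}) :
  \sum_(v in R) 'C(#|V :\: nbr v|, k) =
  \sum_(I : {set G} | (I \subset V) && (#|I| == k)) #|R :&: nonnbr I|.
Proof.
transitivity (\sum_(v in R)
    \sum_(I : {set G} | (I \subset V) && (#|I| == k)) (I \subset ~: nbr v) : nat).
  apply: eq_bigr => v _; rewrite -cards_draws -sum1_card.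
  rewrite big_mkcond [RHS]big_mkcond /=; apply: eq_bigr => I _.
  rewrite !inE setDE subsetI.
  by case: (I \subset V); case: (I \subset ~: nbr v); case: (#|I| == k).
rewrite exchange_big /=; apply: eq_bigr => I _.
rewrite -sum1_card big_mkcond [RHS]big_mkcond /=; apply: eq_bigr => v _.
by rewrite !inE; case: (v \in R); case: (_ \subset _).
Qed.

Lemma sum_draws k V z :
  \sum_(I : {set G} | (I \subset V) && (#|I| == k)) z = 'C(#|V|, k) * z.
Proof.
rewrite sum_nat_const -cards_draws; congr (_ * _).
by apply: eq_card => I; rewrite !inE.
Qed.

(** At most [k * d] vertices of [R] are adjacent to some member of a given [k]-subset of [V]; the
    bound is the sum over all these subsets. *)
Lemma sum_bin_ge k d V (R : {set G}) : {in V, forall u, #|R :&: nbr u| <= d} ->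
  'C(#|V|, k) * #|R| <=
  \sum_(v in R) 'C(#|V :\: nbr v|, k) + 'C(#|V|, k) * (k * d).
Proof.
move=> degR; rewrite sum_bin_nonnbr -!sum_draws -big_split /=.
apply: leq_sum => I /andP[/subsetP IV /eqP cI].
rewrite -(cardsID (nonnbr I) R) leq_add2l.
apply: (@leq_trans #|\bigcup_(u in I) (R :&: nbr u)|).
  apply/subset_leq_card/subsetP => v; rewrite !inE => /andP[/subsetPn[u uI uv] vR].
  by apply/bigcupP; exists u; rewrite // !inE vR adj_sym; move: uv; rewrite !inE negbK.
apply: leq_trans (card_bigcup_le _ _) _; rewrite -cI -sum_nat_const.
by apply: leq_sum => u uI; apply/degR/IV.
Qed.

(** For an independent [I], [nonnbr I] contains [I] itself, so [n] counts the whole book in the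
    complement, spine included. *)
Definition small_books k n :=
  forall I, indep I -> #|I| = k -> #|nonnbr I| < n.

Lemma sum_bin_le k n V : small_books k n -> indep V ->
  \sum_(v : G) 'C(#|V :\: nbr v|, k) <= 'C(#|V|, k) * n.-1.
Proof.
move=> sb iV; rewrite -sum_draws (eq_bigl (mem [set: G])) => [|v]; last by rewrite /= inE.
rewrite sum_bin_nonnbr; apply: leq_sum => I /andP[IV /eqP cI].
by rewrite setTI; have := sb I (indepS IV iV) cI; case: (n).
Qed.

(** Joined sets are disjoint because adjacency is irreflexive, so [rcons l X] describes a copy of
    $K_{q+1}(t, ..., t, m)$. *)
Definition multipartite_free q t m :=
  forall (l : seq {set G}) X, size l = q -> pairwise joined (rcons l X) ->
    all (fun A => t <= #|A|) l -> #|X| < m.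

End Graph.

(* Here and below c stands for 1 / delta: a set is of linear size when c times its
   cardinal is at least n, and the last part of size m satisfies c * m <= n. *)
Lemma dense_multipartite s t q : exists c, forall (G : sgraph) (W : {set G}) m,
  0 < s -> 0 < t -> c <= #|W| -> c * m <= #|W| ->
  (forall I : {set G}, I \subset W -> indep I -> #|I| <> s) ->
  exists l X, [/\ size l = q, pairwise (@joined G) (rcons l X),
    all (fun A : {set G} => t <= #|A|) l,
    all (fun A : {set G} => A \subset W) (rcons l X) & m <= #|X|].
Proof.
elim: q => [|q [c IH]].
  exists 1 => G W m _ _ _; rewrite mul1n => mW _; exists [::], W.
  by rewrite /= subxx.
pose T := 4 * s * t.
(* Passing from [W] to [X1] costs a factor [4 * s], and fixing a trace on [T] vertices a factor
   [2 ^ T]; the summand [2 * (T + s) + 1] makes [H] large enough. *)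
exists (4 * s * 2 ^ T * c + 2 * (T + s) + 1) => G W m s0 t0 cW cmW noI.
pose H := [set x in W | #|W| <= 2 * s * #|nbr x :&: W|].
have TH : T <= #|H|.
  rewrite leqNgt; apply/negP => HT.
  have [|I [IY iI cI]] := @indep_greedy G (#|W| %/ (2 * s)).+1 (W :\: H).
    move=> x; rewrite !inE => /andP[+ xW]; rewrite xW /= -ltnNge => h.
    rewrite ltnS leq_divRL; last by lia.
    apply: leq_trans (ltnW h); rewrite mulnC leq_mul2l.
    by rewrite subset_leq_card ?orbT // setIS // subsetDl.
  have Is : #|I| < s.
    rewrite ltnNge; apply/negP => /subset_card[J JI cJ].
    by apply: (noI J) cJ; [rewrite (subset_trans JI) // (subset_trans IY) // subsetDl|apply: indepS iI].
  have HW : #|H| + #|W :\: H| = #|W|.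
    rewrite -(cardsID H W) (setIidPr _) //.
    by apply/subsetP => x; rewrite inE => /andP[].
  have := leq_trunc_div #|W| (2 * s).
  move: (#|W| %/ (2 * s)) cI => d cI h.
  have : d.+1 * #|I| <= d * s + s by apply: leq_trans (leq_mul (leqnn _) (ltnW Is)) _; rewrite mulSn addnC.
  have h2 : d * (2 * s) = 2 * (d * s) by lia.
  move: (4 * s * 2 ^ T * c) cW => z; lia.
have [D DH cD] := subset_card TH.
(* By double counting, a vertex of [W] has on average at least [T / (2 * s) = 2 * t] neighbours in
   [D], so a proportion [1 / (4 * s)] of [W] has at least [t]. *)
pose X1 := [set x in W | t <= #|nbr x :&: D|].
have X1W : X1 \subset W by apply/subsetP => x; rewrite inE => /andP[].
have cX1 : #|W| <= 4 * s * #|X1|.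
  have e1 : T * #|W| <= 2 * s * \sum_(x in D) #|nbr x :&: W|.
    rewrite big_distrr /= -cD -sum_nat_const; apply: leq_sum => x xD.
    by have := subsetP DH x xD; rewrite inE => /andP[].
  have e2 : \sum_(x in W) #|nbr x :&: D| <= T * #|X1| + t * #|W|.
    rewrite (bigID (mem X1)) /=; apply: leq_add.
      rewrite mulnC -sum_nat_const.
      rewrite (eq_bigl (mem X1)) => [|x].
        by apply: leq_sum => x _; rewrite -cD subset_leq_card ?subsetIr.
      by rewrite /= !inE; case: (x \in W).
    rewrite mulnC -sum_nat_const big_mkcond [X in _ <= X]big_mkcond /=.
    apply: leq_sum => x _; case xW: (x \in W) => //=; rewrite !inE xW /=.
    by case: ifP => //; rewrite -ltnNge => /ltnW.
  rewrite -sum_nbrC in e2.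
  have e3 : T * #|W| <= 2 * s * (T * #|X1| + t * #|W|).
    by apply: (leq_trans e1); rewrite leq_mul2l e2 orbT.
  have : 2 * s * t * #|W| <= 2 * s * t * (4 * s * #|X1|).
    by rewrite /T in e3; nia.
  by rewrite leq_pmul2l // !muln_gt0 s0 t0.
have [D0 cD0] := card_trace X1 D; rewrite cD in cD0.
set X2 := [set x in X1 | _] in cD0.
have X2W : X2 \subset W.
  by apply: subset_trans X1W; apply/subsetP => x; rewrite inE => /andP[].
have cX2 : #|W| <= 4 * s * 2 ^ T * #|X2|.
  by apply: (leq_trans cX1); rewrite -(mulnA (4 * s)) leq_mul2l cD0 orbT.
have pT : 0 < 4 * s * 2 ^ T by rewrite !muln_gt0 s0 expn_gt0.
have X2nb x : x \in X2 -> nbr x :&: D = D0 by rewrite inE => /andP[_ /eqP].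
have [|||||l [X [sl jl tl Wl mX]]] := IH G X2 m.
- by [].
- by [].
- by rewrite -(leq_pmul2l pT) (leq_trans _ cX2) // (leq_trans _ cW) // -addnA leq_addr.
- rewrite -(leq_pmul2l pT) (leq_trans _ cX2) // (leq_trans _ cmW) //.
  by rewrite mulnA leq_mul2r -addnA leq_addr orbT.
- by move=> I IX; apply: noI; apply: subset_trans IX X2W.
have [x xX2] : exists x, x \in X2.
  apply/set0Pn; rewrite -card_gt0; move: cX2 cW; case: #|X2| => //; lia.
have tD0 : t <= #|D0|.
  by rewrite -(X2nb x xX2); move: xX2; rewrite !inE => /andP[/andP[]].
exists (D0 :: l), X; split=> //=.
- by rewrite sl.
- rewrite jl andbT; apply/allP => B Bl; apply/joinedP => a b aD0 bB.
  have bX2 : b \in X2 by apply: (subsetP (allP Wl B Bl)).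
  by move: aD0; rewrite -(X2nb b bX2) inE in_nbr adj_sym => /andP[].
- by rewrite tD0.
- apply/andP; split.
    apply/subsetP => a; rewrite -(X2nb x xX2) inE => /andP[_ aD].
    by have := subsetP DH a aD; rewrite inE => /andP[].
  by apply/allP => B /(allP Wl) /subset_trans; apply.
Qed.

(** * Powers, falling factorials and binomial coefficients *)

Lemma ffact_leq_exp n k : n ^_ k <= n ^ k.
Proof.
elim: k n => [|k IH] n; first by rewrite ffactn0.
rewrite ffactnS expnS leq_mul2l; apply/orP; right.
apply: (leq_trans (IH _)); case: k {IH} => // k.
by rewrite leq_exp2r ?leq_pred.
Qed.

Lemma exp_leq_ffact n k : (n - k) ^ k <= n ^_ k.
Proof.
elim: k n => [|k IH] n; first by rewrite ffactn0.
rewrite ffactnS expnS; apply: leq_mul; first exact: leq_subr.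
apply: leq_trans (IH _); case: k {IH} => // k.
by rewrite leq_exp2r //; lia.
Qed.

(** Bernoulli's inequality $(1 - x/s)^k \ge 1 - kx/s$ with denominators cleared. *)
Lemma expn_sub_leq k s x : x <= s -> s ^ k * s <= s * (s - x) ^ k + k * x * s ^ k.
Proof.
move=> xs; elim: k => [|k IH]; first by rewrite !expn0; lia.
have h : (s - x) ^ k <= s ^ k by case: (k) => // j; rewrite leq_exp2r // leq_subr.
rewrite !expnS; move: (s ^ k) ((s - x) ^ k) IH h => a b IH h.
have : x * s * b <= x * s * a by rewrite leq_mul2l h orbT.
have : s * (a * s) <= s * (s * b + k * x * a) by rewrite leq_mul2l IH orbT.
have : s * b * s = s * b * (s - x) + s * b * x by rewrite -mulnDr subnK.
lia.
Qed.

(** Up to [k!] a binomial lies between [(n - k) ^ k] and [n ^ k]; Bernoulli's inequality with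
    [x = h + k] compares the powers. *)
Lemma bin_sub_ratio k K s h : K.+1 * k * (h + k) <= s ->
  K * 'C(s, k) <= K.+1 * 'C(s - h, k).
Proof.
case: k => [|k] hs; first by rewrite !bin0; lia.
have xs : h + k.+1 <= s by nia.
rewrite -(leq_pmul2r (fact_gt0 k.+1)) -!mulnA !bin_ffact.
have s0 : 0 < s by lia.
have h1 : K * (s ^ k.+1) <= K.+1 * (s - h - k.+1) ^ k.+1.
  rewrite -subnDA -(leq_pmul2l s0).
  have := expn_sub_leq k.+1 xs.
  move: (s ^ k.+1) ((s - _) ^ k.+1) => a b ab.
  have : K.+1 * k.+1 * (h + k.+1) * a <= s * a by rewrite leq_mul2r hs orbT.
  have : K.+1 * (a * s) <= K.+1 * (s * b + k.+1 * (h + k.+1) * a).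
    by rewrite leq_mul2l ab orbT.
  by rewrite mulnDr !mulnA; lia.
apply: leq_trans (leq_trans h1 _).
  by rewrite leq_mul2l ffact_leq_exp orbT.
by rewrite leq_mul2l exp_leq_ffact orbT.
Qed.

(** For [s] this large, [s %/ e - k] is still at least [s / (2 * e)]; powers then bound the falling
    factorials. *)
Lemma bin_divn_ratio k e s : 0 < e -> 2 * e * k.+1 <= s ->
  'C(s, k) <= (2 * e) ^ k * 'C(s %/ e, k).
Proof.
move=> e0 hs; rewrite -(leq_pmul2r (fact_gt0 k)) -!mulnA !bin_ffact.
apply: leq_trans (ffact_leq_exp _ _) _.
apply: leq_trans (leq_mul (leqnn _) (exp_leq_ffact _ _)).
rewrite -expnMn; case: k hs => // k hs; rewrite leq_exp2r //.
have h := ltn_ceil s e0.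
move: (s %/ e) h => d h.
have : k.+2 <= d by rewrite -ltnS -(ltn_pmul2r e0); lia.
move=> kd; have -> : d = (d - k.+1) + k.+1 by lia.
rewrite addnK; nia.
Qed.

Lemma pairwise_uniq (T : eqType) (r : rel T) (s : seq T) : uniq s ->
  {in s &, forall x y, x != y -> r x y} -> pairwise r s.
Proof.
elim: s => //= x s IH /andP[xs us] h; rewrite IH // => [|y z ys zs]; last first.
  by apply: h; rewrite inE (ys, zs) orbT.
rewrite andbT; apply/allP => y ys; apply: h; rewrite ?inE ?eqxx ?ys ?orbT //.
by apply: contraNneq xs => ->.
Qed.

(** * Joined independent sets *)

Definition skeleton (G : sgraph) q s (V : nat -> {set G}) :=
  (forall i, i < q -> #|V i| = s /\ indep (V i)) /\
  (forall i j, i < q -> j < q -> i != j -> joined (V i) (V j)).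

(** [card_trace] is applied to the union of the parts, of size at most [q * s]; [T i] is the common
    trace of [X'] on [V i]. *)
Lemma skeleton_trace (G : sgraph) q s t (V : nat -> {set G}) (X : {set G}) :
  skeleton q s V -> 0 < #|X| ->
  (forall x i, x \in X -> i < q -> t <= #|nbr x :&: V i|) ->
  exists (T : nat -> {set G}) (X' : {set G}), [/\ X' \subset X, #|X| <= 2 ^ (q * s) * #|X'| &
    forall i, i < q -> [/\ T i \subset V i, t <= #|T i| & joined (T i) X']].
Proof.
move=> [cV jV] X0 tX; pose D := \bigcup_(i < q) V i.
have cD : #|D| <= q * s.
  apply: leq_trans (card_bigcup_le _ _) _.
  rewrite (eq_bigr (fun=> s)) => [|i _]; last by have [] := cV i (ltn_ord i).
  by rewrite sum_nat_const card_ord.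
have [D0 cX] := card_trace X D; set X' := [set x in X | _] in cX.
have X'X : X' \subset X by apply/subsetP => x; rewrite inE => /andP[].
exists (fun i => D0 :&: V i), X'; split=> // [|i iq].
  by apply: (leq_trans cX); rewrite leq_mul2r leq_exp2l ?cD ?orbT.
have E x : x \in X' -> D0 :&: V i = nbr x :&: V i.
  rewrite inE => /andP[_ /eqP <-]; rewrite -setIA; congr (_ :&: _).
  by apply/setIidPr; apply: (bigcup_sup (Ordinal iq)).
split; first exact: subsetIr.
  have [|x xX'] := @set0Pn _ X' _.
    by rewrite -card_gt0; move: cX X0; case: #|X'| => //; rewrite muln0; case: #|X|.
  by rewrite (E x xX'); apply: tX => //; apply: (subsetP X'X).
apply/joinedP => a x + xX'; rewrite (E x xX') inE in_nbr adj_sym.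
by case/andP.
Qed.

Lemma few_full (G : sgraph) q s t m (V : nat -> {set G}) :
  multipartite_free G q t m -> skeleton q s V ->
  #|[set x | [forall i : 'I_q, t <= #|nbr x :&: V i|]]| <= 2 ^ (q * s) * m.
Proof.
move=> free skV; set X := [set x | _].
have [X0|X0] := posnP #|X|; first by rewrite X0.
have [|T [X' [_ cX TX]]] := skeleton_trace (t := t) skV X0.
  by move=> x i; rewrite inE => /forallP h iq; apply: (h (Ordinal iq)).
apply: (leq_trans cX); rewrite leq_mul2l; apply/orP; right; apply: ltnW.
apply: (free [seq T i | i <- iota 0 q]); first by rewrite size_map size_iota.
  rewrite pairwise_rcons pairwise_map; apply/andP; split.
    apply/allP => A /mapP[i]; rewrite mem_iota => /andP[_ iq] ->.
    by have [] := TX i iq.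
  apply: pairwise_uniq (iota_uniq _ _) _ => i j; rewrite !mem_iota /= => iq jq ij.
  have [Ti _ _] := TX i iq; have [Tj _ _] := TX j jq.
  by apply: joinedS (skV.2 i j iq jq ij).
apply/allP => A /mapP[i]; rewrite mem_iota => /andP[_ iq] ->.
by have [] := TX i iq.
Qed.

(** A vertex with fewer than [s] neighbours in [V] has weight at least ['C(#|V| - s, k)], and
    [sum_bin_le] bounds the total weight. *)
Lemma few_low_degree (G : sgraph) k n K s (V : {set G}) :
  small_books G k n -> indep V -> k <= #|V| ->
  K * 'C(#|V|, k) <= K.+1 * 'C(#|V| - s, k) ->
  K * #|[set v | #|nbr v :&: V| < s]| <= K.+1 * n.-1.
Proof.
move=> sb iV kV hK; set B := [set v | _].
have M0 : 0 < 'C(#|V|, k) by rewrite bin_gt0.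
have h : #|B| * 'C(#|V| - s, k) <= 'C(#|V|, k) * n.-1.
  apply: leq_trans (sum_bin_le sb iV); rewrite -sum_nat_const.
  rewrite big_mkcond; apply: leq_sum => v _; case: ifP => //; rewrite inE => vB.
  apply: leq_bin2l; have := cardsID (nbr v) V; rewrite setIC; lia.
rewrite -(leq_pmul2l M0).
have : K.+1 * (#|B| * 'C(#|V| - s, k)) <= K.+1 * ('C(#|V|, k) * n.-1).
  by rewrite leq_mul2l h.
have : #|B| * (K * 'C(#|V|, k)) <= #|B| * (K.+1 * 'C(#|V| - s, k)).
  by rewrite leq_mul2l hK orbT.
move: 'C(_, _) 'C(_, _) => a b; lia.
Qed.

(** Induction on [r]: given a skeleton with larger parts and [r < q], linearly many vertices have
    [s] neighbours in every part. An independent [s]-set among those with one common trace is the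
    next part. *)
Lemma skeleton_exists k q t r : forall s, exists c, forall (G : sgraph) n m,
  0 < t -> r <= q -> 0 < s -> c <= n -> c * m <= n ->
  small_books G k n -> multipartite_free G q t m -> q * n.-1 <= #|G| ->
  exists V : nat -> {set G}, skeleton r s V.
Proof.
elim: r => [|r IH] s.
  by exists 0 => G n m *; exists (fun=> set0); split.
pose S := (2 * q).+1 * k * (s + k) + s + k.
have [c1 IH1] := IH S.
have [c2 dm] := dense_multipartite s t q.
exists (c1 + 4 * 2 ^ (r * S) * c2 + 2) => G n m t0 rq s0 cn cmn sb free cG.
have [||||||V skV] := IH1 G n m t0 (ltnW rq) => //; first [by rewrite /S; lia | by nia | idtac].
pose X := [set x : G | [forall i : 'I_r, s <= #|nbr x :&: V i|]].
have XC : ~: X \subset \bigcup_(i < r) [set v | #|nbr v :&: V i| < s].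
  apply/subsetP => v; rewrite !inE negb_forall => /existsP[i hi].
  by apply/bigcupP; exists i => //; rewrite inE ltnNge.
have cXC : 2 * q * #|~: X| <= r * ((2 * q).+1 * n.-1).
  apply: (@leq_trans (2 * q * \sum_(i < r) #|[set v | #|nbr v :&: V i| < s]|)).
    rewrite leq_mul2l (leq_trans (subset_leq_card XC)) ?orbT //.
    exact: card_bigcup_le.
  rewrite big_distrr /= -[X in _ <= X * _](card_ord r) -sum_nat_const.
  apply: leq_sum => i _; have [cV iV] := skV.1 i (ltn_ord i).
  apply: (few_low_degree (k := k)) => //; rewrite cV /S; first lia.
  by apply: bin_sub_ratio; lia.
(* For each of the [r < q] parts, at most [(1 + 1 / (2 * q)) * n.-1] vertices have fewer than [s]
   neighbours in it, so at least [n.-1 / 2] vertices remain. *)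
have X2 : n.-1 <= 2 * #|X|.
  rewrite -(leq_pmul2l (_ : 0 < q)); last by lia.
  have hX := cardsC X.
  have : r.+1 * n.-1 <= q * n.-1 by rewrite leq_mul2r rq orbT.
  have : 2 * q * #|G| = 2 * q * #|X| + 2 * q * #|~: X| by rewrite -mulnDr hX.
  have : 2 * q * (q * n.-1) <= 2 * q * #|G| by rewrite leq_mul2l cG orbT.
  have : r * n.-1 <= q * n.-1 by rewrite leq_mul2r ltnW ?orbT.
  have : 2 * q * (r.+1 * n.-1) <= 2 * q * (q * n.-1) by rewrite leq_mul2l leq_mul2r rq !orbT.
  lia.
have X0 : 0 < #|X| by lia.
have [|T [X' [X'X cX TX]]] := skeleton_trace (t := s) skV X0.
  by move=> x i; rewrite inE => /forallP h ir; apply: (h (Ordinal ir)).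
have nX' : n <= 4 * 2 ^ (r * S) * #|X'| by rewrite -mulnA; lia.
have p0 : 0 < 4 * 2 ^ (r * S) by rewrite muln_gt0 expn_gt0.
have [/existsP[W /and3P[WX' iW /eqP cW]]|noW] :=
  boolP [exists W : {set G}, [&& W \subset X', indep W & #|W| == s]]; last first.
  have [|||l [Y [sl jl tl _ mY]]] := dm G X' m s0 t0.
  - by rewrite -(leq_pmul2l p0); lia.
  - rewrite -(leq_pmul2l p0) (leq_trans _ nX') // (leq_trans _ cmn) //.
    by rewrite mulnA leq_mul2r; apply/orP; right; lia.
  - move=> I IX iI cI; case/negP: noW; apply/existsP; exists I.
    by rewrite IX iI cI eqxx.
  - by have := free l Y sl jl tl; rewrite ltnNge mY.
have Tsub i : i < r -> exists B : {set G}, (B \subset T i) && (#|B| == s).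
  move=> ir; have [_ /subset_card[B BT cB] _] := TX i ir.
  by exists B; rewrite BT cB eqxx.
pose V' i := if i == r then W else odflt set0 [pick B : {set G} | (B \subset T i) && (#|B| == s)].
have V'r : V' r = W by rewrite /V' eqxx.
have V'i i : i < r -> V' i \subset T i /\ #|V' i| = s.
  move=> ir; rewrite /V' ltn_eqF //; case: pickP => [B /andP[-> /eqP]//|h].
  by have [B] := Tsub i ir; rewrite h.
have V'W i : i < r -> joined (V' i) W.
  move=> ir; have [BT _] := V'i i ir; have [_ _ jT] := TX i ir.
  by apply: joinedS jT.
exists V'; split=> [i|i j]; rewrite !ltnS.
  rewrite leq_eqVlt => /predU1P[->|ir]; first by rewrite V'r.
  have [VT cV] := V'i i ir; split=> //.
  have [TV _ _] := TX i ir.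
  by apply: indepS (skV.1 i ir).2; apply: subset_trans VT TV.
rewrite leq_eqVlt => /predU1P[->|ir]; rewrite leq_eqVlt => /predU1P[->|jr].
- by rewrite eqxx.
- by move=> _; rewrite V'r joined_sym; apply: V'W.
- by move=> _; rewrite V'r; apply: V'W.
move=> ij; have [iT _] := V'i i ir; have [jT _] := V'i j jr.
have [iV _ _] := TX i ir; have [jV _ _] := TX j jr.
by apply: joinedS (skV.2 i j ir jr ij); [apply: subset_trans iT iV|apply: subset_trans jT jV].
Qed.

(** Type [i] marks vertices that behave like further members of [V i]; [1 / e] is the proportion of
    each other part that they may miss. *)
Definition typed (G : sgraph) q s t e (V : nat -> {set G}) (i : nat) v :=
  (#|nbr v :&: V i| < t) &&
  [forall j : 'I_q, (val j != i) ==> (e * #|V j :\: nbr v| <= s)].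

Definition untyped (G : sgraph) q s t e (V : nat -> {set G}) :=
  [set v | [forall i : 'I_q, ~~ typed q s t e V i v]].

(* Each vertex outside few_full misses almost all of some part, and an untyped
   one also misses a fixed proportion of another part; as the weights
   'C(#|V j :\: nbr v|, k) / 'C(s, k) sum to at most q * n.-1 <= #|G|, there is
   no room for many untyped vertices. *)
Lemma few_untyped k q t e E : 0 < q -> 0 < e -> 0 < E ->
  exists s0, forall s, s0 <= s ->
  exists c, forall (G : sgraph) n m (V : nat -> {set G}),
  c <= n -> c * m <= n ->
  small_books G k n -> multipartite_free G q t m -> q * n.-1 <= #|G| ->
  skeleton q s V -> E * #|untyped q s t e V| <= n.
Proof.
move=> q0 e0 E0.
(* [L] is the loss in [bin_divn_ratio]. [K] makes the error [L * q * n / K] equal to [n / (2 * E)];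
   the vertices of [F] take up the other half. *)
pose L := (2 * e) ^ k; pose K := 2 * E * L * q.
have L0 : 0 < L by rewrite expn_gt0 muln_gt0 e0.
exists (K.+1 * k * (t + k) + 2 * e * k.+1 + k) => s hs.
exists (2 * E * L.+1 * 2 ^ (q * s)) => G n m V cn cmn sb free cG skV.
set U := untyped q s t e V.
pose F := [set x : G | [forall i : 'I_q, t <= #|nbr x :&: V i|]].
have cF : #|F| <= 2 ^ (q * s) * m := few_full free skV.
pose M := 'C(s, k); have M0 : 0 < M by rewrite bin_gt0; lia.
pose d (j : nat) v := 'C(#|V j :\: nbr v|, k).
(* In units of [M], a vertex outside [F] has total weight at least [K / K.+1], and an untyped one
   [1 / L] more; the last summand covers the vertices of [F]. *)
have dS v : (K * L + K.+1 * (v \in U)) * M <=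
    K.+1 * L * \sum_(j < q) d j v + (v \in F) * ((L + 1) * K.+1 * M).
  have [vF|] := boolP (v \in F); first by case: (v \in U); nia.
  rewrite inE negb_forall => /existsP[i hi]; rewrite mul0n addn0.
  have di : K * M <= K.+1 * d i v.
    have h : K * 'C(s, k) <= K.+1 * 'C(s - t, k) by apply: bin_sub_ratio; lia.
    apply: (leq_trans h); rewrite leq_mul2l leq_bin2l //=.
    have := cardsID (nbr v) (V i); have [-> _] := skV.1 i (ltn_ord i).
    by rewrite setIC; lia.
  rewrite (bigD1 i) //=.
  have [vU|vU] := boolP (v \in U); last first.
    rewrite muln0 addn0.
    have := leq_mul (leqnn L) di; move: (\sum_(j < q | _) _) => z; nia.
  have /existsP[j] : [exists j : 'I_q, (j != i) && (s < e * #|V j :\: nbr v|)].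
    move: vU; rewrite inE => /forallP/(_ i); rewrite /typed ltnNge hi /=.
    rewrite negb_forall => /existsP[j]; rewrite negb_imply -ltnNge => /andP[ji h].
    by apply/existsP; exists j; rewrite h andbT.
  move=> /andP[ji hj].
  have dj : M <= L * d j v.
    have h : 'C(s, k) <= L * 'C(s %/ e, k) by apply: bin_divn_ratio; lia.
    apply: (leq_trans h); rewrite leq_mul2l leq_bin2l ?orbT //.
    by apply: leq_trans (leq_div2r e (ltnW hj)) _; rewrite mulKn.
  rewrite (bigD1 j) //= muln1.
  have := leq_mul (leqnn L) di; have := leq_mul (leqnn K.+1) dj.
  move: (\sum_(l < q | _) _) => z; nia.
have : \sum_v (K * L + K.+1 * (v \in U)) * M <=
    \sum_v (K.+1 * L * \sum_(j < q) d j v + (v \in F) * ((L + 1) * K.+1 * M)).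
  by apply: leq_sum => v _; apply: dS.
have sumU (A : {set G}) : \sum_v (v \in A : nat) = #|A|.
  by rewrite -sum1_card [RHS]big_mkcond; apply: eq_bigr => v _; case: ifP.
rewrite -big_distrl big_split /= sum_nat_const -big_distrr /= sumU.
rewrite big_split /= -big_distrr -[\sum_(i : G) (_ \in F) * _]big_distrl /= sumU exchange_big /=.
have : \sum_(j < q) \sum_v d j v <= q * (M * n.-1).
  rewrite -[X in _ <= X * _](card_ord q) -sum_nat_const; apply: leq_sum => j _.
  have [cV iV] := skV.1 j (ltn_ord j).
  by have := sum_bin_le sb iV; rewrite cV.
move: (\sum_(j < q) _) => z hz h.
have {}h : (#|G| * (K * L) + K.+1 * #|U|) * M <=
   (K.+1 * L * (q * n.-1) + #|F| * ((L + 1) * K.+1)) * M.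
  apply: (leq_trans h); have := leq_mul (leqnn (K.+1 * L)) hz.
  move: (M) (L) (K) #|F| => M' L' K' F'; clear; lia.
rewrite leq_pmul2r // in h.
have h2 : q * n.-1 * (K * L) <= #|G| * (K * L) by rewrite leq_mul2r cG orbT.
have h3 : K.+1 * #|U| <= L * (q * n.-1) + #|F| * ((L + 1) * K.+1).
  move: h h2; move: (L) (K) #|F| #|U| => L' K' F' U'; clear; lia.
have h4 : 2 * E * L.+1 * #|F| <= n.
  apply: leq_trans cmn; rewrite -!mulnA !leq_mul2l; by rewrite cF !orbT.
rewrite -(leq_pmul2l (_ : 0 < 2 * K.+1)) //.
have h5 : 2 * E * (K.+1 * #|U|) <= 2 * E * (L * (q * n.-1) + #|F| * ((L + 1) * K.+1)).
  by rewrite leq_mul2l h3 orbT.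
have h6 : K.+1 * (2 * E * L.+1 * #|F|) <= K.+1 * n by rewrite leq_mul2l h4 orbT.
have h7 : 2 * E * (L * (q * n.-1)) <= K.+1 * n.
  have -> : 2 * E * (L * (q * n.-1)) = K * n.-1 by rewrite /K !mulnA.
  by apply: leq_mul => //; apply: leq_pred.
move: h5 h6 h7; rewrite addn1; move: (K) (L) => K' L'; clear.
rewrite mulnDr; move: (2 * E * (L' * _)) => y; lia.
Qed.

(** By [few_low_degree] no class exceeds [(1 + 1 / K) * n.-1]. Classes and untyped vertices cover
    [G], so class [i] must take what the others leave. *)
Lemma card_typed_ge (G : sgraph) k q s t e n K (V : nat -> {set G}) (i : 'I_q) :
  small_books G k n -> skeleton q s V -> k <= s ->
  K * 'C(s, k) <= K.+1 * 'C(s - t, k) -> q * n.-1 <= #|G| ->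
  K * (q * n.-1) <=
  K * #|[set v | typed q s t e V i v]| + q.-1 * (K.+1 * n.-1) + K * #|untyped q s t e V|.
Proof.
move=> sb skV ks hK cG; pose U (j : 'I_q) := [set v | typed q s t e V j v].
have cU j : K * #|U j| <= K.+1 * n.-1.
  have [cV iV] := skV.1 j (ltn_ord j).
  apply: leq_trans (few_low_degree sb iV _ _); last 2 first.
  - by rewrite cV.
  - by rewrite cV; apply: hK.
  rewrite leq_mul2l; apply/orP; right; apply/subset_leq_card/subsetP => v.
  by rewrite !inE => /andP[].
apply: (@leq_trans (K * #|G|)); first by rewrite leq_mul2l cG orbT.
have -> : #|G| = #|[set: G]| by rewrite cardsT.
have sub : [set: G] \subset
    (U i :|: \bigcup_(j | j != i) U j) :|: untyped q s t e V.
  apply/subsetP => v _; rewrite in_setU; apply/orP.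
  have [vU|] := boolP (v \in untyped q s t e V); first by right.
  rewrite inE negb_forall => /existsP[j]; rewrite negbK => vj; left.
  rewrite !inE; have [<-|ji] := eqVneq j i; first by rewrite vj.
  by apply/orP; right; apply/bigcupP; exists j; rewrite // inE.
apply: (@leq_trans (K * (#|U i| + \sum_(j | j != i) #|U j| + #|untyped q s t e V|))).
  rewrite leq_mul2l; apply/orP; right; apply: (leq_trans (subset_leq_card sub)).
  apply: leq_trans (leq_card_setU _ _) _; rewrite leq_add2r.
  apply: leq_trans (leq_card_setU _ _) _; rewrite leq_add2l.
  exact: card_bigcup_le.
rewrite !mulnDr leq_add2r leq_add2l big_distrr /=.
apply: (@leq_trans (\sum_(j : 'I_q | j != i) K.+1 * n.-1)); first exact: leq_sum.
by rewrite sum_nat_const cardC1 card_ord -mulnDr.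
Qed.

(* The sets A i consist of vertices typed for a first skeleton V.  If linearly many
   of those typed i missed a positive proportion of another class, an independent
   set W of such vertices could replace V i; but for the resulting skeleton most
   vertices of the class j <> i are typed j, hence adjacent to almost all of W. *)
Lemma near_complete k q t B : 0 < t -> 0 < q -> 0 < B ->
  exists c, forall (G : sgraph) n m, c <= n -> c * m <= n ->
  small_books G k n -> multipartite_free G q t m ->
  q * n.-1 <= #|G| <= 2 * q * n ->
  exists A : nat -> {set G}, forall i, i < q ->
    n <= 4 * #|A i| /\
    forall j, j < q -> j != i -> {in A i, forall u, B * #|A j :\: nbr u| <= n}.
Proof.
move=> t0 q0 B0.
(* In the final count each of two error terms is at most half of [e2 * z * n]: [e2] controls the
   term in [#|G|], [E2] the one in [#|Un|]. *)
pose e2 := 4 * B * q * q; pose E2 := 2 * B * q.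
have e20 : 2 <= e2 by rewrite /e2; nia.
have [s2 few2] := @few_untyped k q t e2 E2 q0 (ltnW e20) ltac:(rewrite /E2; nia).
pose z := s2 + 2 * t; have z0 : 0 < z by rewrite /z; lia.
have {}few2 := few2 z (leq_addr _ _).
have [c2 {}few2] := few2.
have [s1 few1] := @few_untyped k q t (2 * z) 8 q0 ltac:(lia) isT.
pose s := s1 + 2 * z + k + (8 * q).+1 * k * (t + k).
have [c1 {}few1] := few1 s ltac:(rewrite /s; lia).
have [c3 sk] := skeleton_exists k q t q s.
have [c4 dm] := dense_multipartite z t q.
exists (c1 + c2 + c3 + 8 * c4 + 8) => G n m cn cmn sb free /andP[cG cG2].
have [||||||||V skV] := sk G n m => //; try (rewrite /s; lia).
have cU1 : 8 * #|untyped q s t (2 * z) V| <= n by apply: (few1 G n m) => //; lia.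
pose U (i : nat) := [set v | typed q s t (2 * z) V i v].
have cU i : i < q -> n <= 2 * #|U i|.
  move=> iq; have ks : k <= s by rewrite /s; lia.
  have hK : 8 * q * 'C(s, k) <= (8 * q).+1 * 'C(s - t, k).
    by apply: bin_sub_ratio; rewrite /s; lia.
  have := card_typed_ge (2 * z) (Ordinal iq) sb skV ks hK cG.
  rewrite /= -/(U i) => h.
  rewrite -(leq_pmul2l (_ : 0 < 8 * q)); last by lia.
  have : q * (8 * #|untyped q s t (2 * z) V|) <= q * n by rewrite leq_mul2l cU1 orbT.
  have n8 : 8 <= n by lia.
  move: n8 h; have [n' ->] : exists n', n = n'.+1 by exists n.-1; lia.
  have [q' Eq] : exists q', q = q'.+1 by exists q.-1; lia.
  rewrite Eq /=; move: #|_| #|_| => x y; clear.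
  move=> n8; have : q'.+1 * 8 <= q'.+1 * n'.+1 by rewrite leq_mul2l n8 orbT.
  lia.
pose bad i := [set u in U i | [exists j : 'I_q, (val j != i) && (n < B * #|U j :\: nbr u|)]].
have badU i : bad i \subset U i by apply/subsetP => u; rewrite inE => /andP[].
have cbad i : i < q -> 8 * #|bad i| <= n.
  move=> iq; rewrite leqNgt; apply/negP => nb.
  have [/existsP[W /and3P[Wb iW /eqP cW]]|noW] :=
    boolP [exists W : {set G}, [&& W \subset bad i, indep W & #|W| == z]]; last first.
    have [|||l [Y [sl jl tl _ mY]]] := dm G (bad i) m z0 t0; try lia.
      move=> I IX iI cI; case/negP: noW; apply/existsP; exists I.
      by rewrite IX iI cI eqxx.
    by have := free l Y sl jl tl; rewrite ltnNge mY.
  (* Each of the [z] vertices of [W] misses at most [s / (2 * z)] of [V j], so at least [s / 2 >= z]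
     vertices of [V j] are adjacent to all of [W]. *)
  have Vsub j : j < q -> j != i -> exists Y : {set G}, (Y \subset V j :&: common W) && (#|Y| == z).
    move=> jq ji; have [cV _] := skV.1 j jq.
    have [|Y YV cY] := @subset_card G z (V j :&: common W); last by exists Y; rewrite YV cY eqxx.
    have := card_common W (V j); rewrite cV.
    have : 2 * z * \sum_(u in W) #|V j :\: nbr u| <= z * s.
      rewrite big_distrr /= -cW -sum_nat_const cW; apply: leq_sum => u uW.
      have := subsetP (badU i) u (subsetP Wb u uW); rewrite inE => /andP[_ /forallP/(_ (Ordinal jq))].
      by rewrite /= ji.
    rewrite -mulnA mulnCA leq_pmul2l //; move: (\sum_(u in W) _) => y.
    have : 2 * z <= s by rewrite /s; lia.
    lia.
  pose V' j := if j == i then W else odflt set0 [pick Y : {set G} | (Y \subset V j :&: common W) && (#|Y| == z)].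
  have V'i : V' i = W by rewrite /V' eqxx.
  have V'j j : j < q -> j != i -> V' j \subset V j :&: common W /\ #|V' j| = z.
    move=> jq ji; rewrite /V' (negPf ji); case: pickP => [Y /andP[-> /eqP]//|h].
    by have [Y] := Vsub j jq ji; rewrite h.
  have V'V j : j < q -> j != i -> V' j \subset V j.
    by move=> jq ji; have [+ _] := V'j j jq ji; rewrite subsetI => /andP[].
  have V'W j : j < q -> j != i -> joined W (V' j).
    move=> jq ji; have [VW _] := V'j j jq ji; apply/joinedP => x y xW yV.
    by have := subsetP VW y yV; rewrite inE => /andP[_ /commonP]; apply.
  have skV' : skeleton q z V'.
    split=> [j jq|j l jq lq jl].
      have [->|ji] := eqVneq j i; first by rewrite V'i.
      have [_ cV] := V'j j jq ji; split=> //.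
      by apply: indepS (V'V j jq ji) (skV.1 j jq).2.
    have [E|ji] := eqVneq j i.
      by rewrite E V'i; apply: V'W => //; rewrite -E eq_sym.
    have [E|li] := eqVneq l i.
      by rewrite E V'i joined_sym; apply: V'W.
    by apply: joinedS (skV.2 j l jq lq jl); apply: V'V.
  have cU2 : E2 * #|untyped q z t e2 V'| <= n by apply: (few2 G n m) => //; lia.
  set Un := untyped q z t e2 V' in cU2.
  (* [v] has fewer than [t] neighbours in [V' j], a set of [z >= 2 * t] vertices, so its type for
     [V'] can only be [j]. *)
  have missW j v : j < q -> j != i -> v \in U j -> v \notin Un -> e2 * #|W :\: nbr v| <= z.
    move=> jq ji vU; rewrite inE negb_forall => /existsP[l]; rewrite negbK => /andP[vl /forallP hl].
    have [E|lj] := eqVneq (val l) j.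
      by have := hl (Ordinal iq); rewrite /= E eq_sym ji V'i.
    have := hl (Ordinal jq); rewrite /= eq_sym lj /= => h.
    have lo : #|nbr v :&: V' j| < t.
      move: vU; rewrite inE => /andP[+ _]; apply: leq_ltn_trans.
      by apply/subset_leq_card/setIS/V'V.
    have [_ cV] := V'j j jq ji.
    have := cardsID (nbr v) (V' j); rewrite cV setIC => hc.
    have : 2 * #|V' j :\: nbr v| <= z by apply: leq_trans h; rewrite leq_mul2r e20 orbT.
    by move: lo hc; rewrite /z; lia.
  have sumW (j : 'I_q) : val j != i ->
      e2 * \sum_(u in W) #|U j :\: nbr u| <= z * #|G| + e2 * z * #|Un|.
    move=> ji; rewrite sum_nonnbrC big_distrr /=.
    apply: (@leq_trans (\sum_(v : G) (z + (v \in Un) * (e2 * z)))).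
      rewrite big_mkcond; apply: leq_sum => v _; case: ifP => // vU.
      have [vUn|vUn] := boolP (v \in Un); last first.
        by rewrite mul0n addn0; apply: (missW j).
      rewrite mul1n; apply: leq_trans (leq_addl _ _); rewrite leq_mul2l.
      by rewrite -cW subset_leq_card ?orbT // subsetDl.
    rewrite big_split /= sum_nat_const mulnC -big_distrl /= mulnC.
    rewrite leq_add2l mulnC leq_mul2l; apply/orP; right.
    by rewrite -sum1_card [leqRHS]big_mkcond; apply: leq_sum => v _; case: (v \in Un).
  (* Every [u] in [W] is bad, so it misses more than [n / B] vertices of some other class; [sumW]
     bounds the same non-adjacent pairs from the other side. *)
  have big : z * n < B * \sum_(j : 'I_q | val j != i) \sum_(u in W) #|U j :\: nbr u|.
    rewrite exchange_big big_distrr /=.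
    have : z * n.+1 <= \sum_(u in W) B * \sum_(j < q | val j != i) #|U j :\: nbr u|.
      rewrite -cW -sum_nat_const; apply: leq_sum => u uW.
      have := subsetP Wb u uW; rewrite inE => /andP[_ /existsP[j /andP[ji h]]].
      by apply: (leq_trans h); rewrite leq_mul2l (bigD1 j) //= leq_addr orbT.
    by apply: leq_trans; rewrite ltn_pmul2l.
  have h1 : e2 * \sum_(j : 'I_q | val j != i) \sum_(u in W) #|U j :\: nbr u| <=
      q * (z * #|G| + e2 * z * #|Un|).
    rewrite big_distrr /= -[X in _ <= X * _](card_ord q) -sum_nat_const.
    by rewrite big_mkcond; apply: leq_sum => j _; case: ifP => // ji; apply: sumW.
  move: big h1; move: (\sum_(j < q | _) _) => y big h1.
  have h2 : e2 * (z * n) < e2 * (B * y) by rewrite ltn_pmul2l // ltnW.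
  have h3 : B * (e2 * y) <= B * (q * (z * #|G| + e2 * z * #|Un|)) by rewrite leq_mul2l h1 orbT.
  have h4 : (B * q * z) * #|G| <= (B * q * z) * (2 * q * n) by rewrite leq_mul2l cG2 orbT.
  have h5 : (e2 * z) * (E2 * #|Un|) <= (e2 * z) * n by rewrite leq_mul2l cU2 orbT.
  have h6 : 2 * ((B * q * z) * (2 * q * n)) = e2 * z * n by rewrite /e2; lia.
  have h7 : (e2 * z) * (E2 * #|Un|) = 2 * (B * q * (e2 * z * #|Un|)) by rewrite /E2; lia.
  lia.
exists (fun i => U i :\: bad i) => i iq; split.
  have := cardsID (bad i) (U i); rewrite (setIidPr (badU i)).
  have := cU i iq; have := cbad i iq; lia.
move=> j jq ji u; rewrite !inE negb_and => /andP[+ uU].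
rewrite uU /= negb_exists => /forallP/(_ (Ordinal jq)).
rewrite /= ji /= -leqNgt; apply: leq_trans.
by rewrite leq_mul2l subset_leq_card ?orbT // setSD // subsetDl.
Qed.

(** * The upper bound *)

(** Excludes $K_{q+1}(1, a, t, ..., t, m)$: besides [L] there are the parts [[set v]], [B] and
    [X]. *)
Definition star_free (G : sgraph) q a t m :=
  forall v (B : {set G}) L X, (size L).+2 = q ->
    pairwise (@joined G) ([set v] :: B :: rcons L X) ->
    a <= #|B| -> all (fun A : {set G} => t <= #|A|) L -> #|X| < m.

Lemma star_free_multipartite (G : sgraph) q a t m : 1 < q -> 0 < a <= t ->
  star_free G q a t m -> multipartite_free G q t m.
Proof.
move=> q1 /andP[a0 aT] sf [|A [|B L]] X; try by move=> /= E; rewrite -E in q1.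
move=> sL jL /= /and3P[tA tB tL].
have /card_gt0P[v vA] : 0 < #|A| by lia.
apply: (sf v B L X) => //; last by lia.
move: jL => /= /andP[/andP[AB /allP AL] ->]; rewrite andbT.
apply/andP; split; first by apply: joinedS AB; rewrite ?sub1set.
by apply/allP => Z /AL; apply: joinedS; rewrite ?sub1set.
Qed.

Definition almost_complete (G : sgraph) q b (A : nat -> {set G}) :=
  forall i j, i < q -> j < q -> i != j -> {in A i, forall u, #|A j :\: nbr u| <= b}.

(** Greedy choice: once [t] vertices are picked in [Y j], every other candidate set is cut down to
    their common neighbours and loses at most [t * b] vertices. The large part [X] comes last, from
    [Y l]. *)
Lemma select_multipartite (G : sgraph) q b t m (A : nat -> {set G}) l js :
  almost_complete q b A -> forall Y : nat -> {set G},
  uniq (l :: js) -> all (fun j => j < q) (l :: js) ->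
  (forall j, j \in l :: js ->
     Y j \subset A j /\ size js * (t * b) + t + m <= #|Y j|) ->
  exists L X, [/\ size L = size js, pairwise (@joined G) (rcons L X),
    all (fun Z : {set G} => t <= #|Z|) L, m <= #|X| &
    forall Z, Z \in rcons L X -> exists2 j, j \in l :: js & Z \subset Y j].
Proof.
move=> Anear; elim: js => [|j js IH] Y.
  move=> _ _ hY; have [|_ cY] := hY l; first by rewrite inE.
  exists [::], (Y l); split=> //; first by lia.
  by move=> Z; rewrite inE => /eqP ->; exists l; rewrite ?inE.
move=> /= /and3P[ljs jjs ujs] /and3P[lq jq jsq] hY.
have [|YA cY] := hY j; first by rewrite !inE eqxx orbT.
have [|T TY cT] := @subset_card G t (Y j); first by lia.
have mem i : i \in l :: js -> [/\ i \in [:: l, j & js], i < q & i != j].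
  rewrite !inE => /predU1P[->|ijs].
    split=> //; first by rewrite eqxx.
    by apply: contraNneq ljs => ->; rewrite inE eqxx.
  split; first by rewrite ijs !orbT.
    by apply: (allP jsq).
  by apply: contraNneq jjs => <-.
have [||i /mem[il iq ij]|L [X [sL jL tL mX ZL]]] := IH (fun i => Y i :&: common T).
- rewrite /= ujs andbT; by apply: contra ljs; rewrite inE => ->; rewrite orbT.
- by rewrite /= lq.
- have [YAi cYi] := hY i il; split; first by apply: subset_trans YAi; apply: subsetIl.
  have := card_common T (Y i).
  suff : \sum_(u in T) #|Y i :\: nbr u| <= t * b by move: cYi => /=; lia.
  rewrite -cT -sum_nat_const; apply: leq_sum => u uT.
  apply: leq_trans (Anear j i jq iq _ u _).
  - by apply/subset_leq_card/setSD.
  - by rewrite eq_sym.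
  - by apply: (subsetP YA); apply: (subsetP TY).
exists (T :: L), X; split=> //=.
- by rewrite sL.
- rewrite jL andbT; apply/allP => Z /ZL[i _ ZY].
  apply/joinedP => x y xT /(subsetP ZY); rewrite inE => /andP[_ /commonP]; exact.
- by rewrite cT leqnn.
- move=> Z; rewrite inE => /predU1P[->|/ZL[i /mem[il _ _] ZY]].
    by exists j => //; rewrite !inE eqxx orbT.
  by exists i => //; apply: subset_trans ZY (subsetIl _ _).
Qed.

Lemma no_common_vertex (G : sgraph) q a b t m (A : nat -> {set G}) v :
  almost_complete q b A -> star_free G q a t m -> 1 < q -> a <= t ->
  ~ (forall i, i < q -> q * (t * b) + t + m <= #|A i :&: nbr v|).
Proof.
move=> Anear sf q1 aT hv.
have [q' Eq] : exists q', q = q'.+2 by exists q.-2; lia.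
have [|||L [X [sL jL tL mX ZL]]] :=
  @select_multipartite G q b t m A 0 (iota 1 q'.+1) Anear (fun i => A i :&: nbr v).
- exact: (iota_uniq 0 q'.+2).
- by apply/allP => j; rewrite -[_ :: _]/(iota 0 q'.+2) mem_iota Eq.
- move=> j; rewrite -[_ :: _]/(iota 0 q'.+2) mem_iota -Eq => jq.
  split; first exact: subsetIl.
  apply: leq_trans (hv j jq); rewrite size_iota !leq_add2r leq_mul2r Eq leqnSn.
  by rewrite orbT.
case: L sL jL tL ZL => [|B L]; first by rewrite size_iota.
rewrite size_iota => -[sL] jL /= /andP[tB tL] ZL.
suff : #|X| < m by rewrite ltnNge mX.
apply: (sf v B L X) => //; last by lia.
  by rewrite sL Eq.
suff /= -> : all (joined [set v]) (B :: rcons L X) by [].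
apply/allP => Z /ZL[j _ ZA]; apply/joinedP => x y /set1P -> /(subsetP ZA).
by rewrite inE in_nbr => /andP[].
Qed.

(** [u] and [S] are the first two parts; the other [q - 1] are chosen among the common neighbours of
    [u |: S] in the [A j] with [j != i]. [S] may lie outside [A i], so that regular vertices can be
    treated too. *)
Lemma no_star (G : sgraph) q a b g t m (A : nat -> {set G}) i u (S : {set G}) :
  almost_complete q b A -> star_free G q a t m -> 1 < q -> i < q -> u \in A i ->
  S \subset nbr u -> #|S| = a ->
  (forall j, j < q -> j != i -> {in S, forall w, #|A j :\: nbr w| <= g}) ->
  ~ (forall j, j < q -> j != i -> b + a * g + (q * (t * b) + t + m) <= #|A j|).
Proof.
move=> Anear sf q1 iq uA Su cS gS cA.
have iI : i \in iota 0 q by rewrite mem_iota.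
have [l [js [mjs ujs sjs]]] : exists (l : nat) (js : seq nat),
    [/\ l :: js =i [predD1 iota 0 q & i], uniq (l :: js) & (size js).+2 = q].
  have := size_rem iI; have := rem_uniq i (iota_uniq 0 q); rewrite size_iota.
  have := mem_rem_uniq i (iota_uniq 0 q).
  case: (rem i (iota 0 q)) => [|l js] mjs ujs /= sjs; first by lia.
  by exists l, js; rewrite sjs prednK // ltnW.
have mem j : j \in l :: js -> j < q /\ j != i.
  by rewrite mjs !inE mem_iota => /andP[].
have [|j /mem[jq ji]|L [X [sL jL tL mX ZL]]] :=
    select_multipartite (t := t) (m := m) Anear (Y := fun j => A j :&: common (u |: S)) ujs.
- by apply/allP => j /mem[].
- split; first exact: subsetIl.
  have := card_common (u |: S) (A j).
  have := cA j jq ji.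
  have h : \sum_(w in u |: S) #|A j :\: nbr w| <= b + a * g.
    rewrite big_setU1 /=; last by apply/negP => /(subsetP Su); rewrite in_nbr adj_irr.
    apply: leq_add; first by apply: (Anear i j) => //; rewrite eq_sym.
    by rewrite -cS -sum_nat_const; apply: leq_sum => w; apply: gS.
  have : size js * (t * b) <= q * (t * b) by rewrite leq_mul2r; apply/orP; right; lia.
  move: (size js * (t * b)) (q * (t * b)) (a * g) h.
  move: (\sum_(w in _) _) #|A j| #|_| => x y z.
  lia.
suff : #|X| < m by rewrite ltnNge mX.
apply: (sf u S L X) => //; first by rewrite sL.
  rewrite /= jL andbT -andbA; apply/and3P; split.
  - by apply/joinedP => x y /set1P -> /(subsetP Su); rewrite in_nbr.
  - apply/allP => Z /ZL[j _ ZY]; apply/joinedP => x y /set1P -> /(subsetP ZY).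
    by rewrite inE => /andP[_ /commonP]; apply; apply: setU11.
  - apply/allP => Z /ZL[j _ ZY]; apply/joinedP => x y xS /(subsetP ZY).
    by rewrite inE => /andP[_ /commonP]; apply; rewrite inE xS orbT.
by rewrite cS.
Qed.

(** By [no_star] each vertex of a set from [near_complete] has fewer than [a] neighbours in its own
    set, so the greedy argument keeps a proportion [1 / a]. *)
Lemma independent_parts k q t B : 0 < t -> 1 < q -> 0 < B ->
  exists c, forall (G : sgraph) n m a, c <= n -> c * m <= n -> 0 < a <= t ->
  small_books G k n -> star_free G q a t m ->
  q * n.-1 <= #|G| <= 2 * q * n ->
  exists A : nat -> {set G}, almost_complete q (n %/ B) A /\
    forall i, i < q -> #|A i| = n %/ (4 * t) /\ indep (A i).
Proof.
move=> t0 q1 B0; pose D := B * (16 * (q * t + t + 1)).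
have [|c nc] := @near_complete k q t D t0 (ltnW q1); first by rewrite /D; lia.
exists (c + 16 * (t + 1)) => G n m a cn cmn at0 sb sf cG.
have [||A hA] := nc G n m _ _ sb (star_free_multipartite q1 at0 sf) cG; try lia.
have AD : almost_complete q (n %/ D) A.
  move=> i j iq jq ij u uA; have [_ h] := hA i iq.
  have := h j jq; rewrite eq_sym => /(_ ij u uA).
  rewrite mulnC -leq_divRL //; rewrite /D; lia.
have iA i : i < q -> exists I : {set G}, [&& I \subset A i, #|I| == n %/ (4 * t) & indep I].
  move=> iq; have [cA _] := hA i iq.
  have [u uA|I [IA iI cI]] := @indep_greedy G a (A i).
    rewrite ltnNge; apply/negP => /subset_card[S SA cS].
    move: SA; rewrite subsetI => /andP[Su SA].
    apply: (no_star AD sf q1 iq uA Su cS (g := n %/ D)).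
      by move=> j jq ji w wS; apply: AD iq jq _ _ (subsetP SA w wS); rewrite eq_sym.
    move=> j jq ji; have [cAj _] := hA j jq.
    rewrite -(leq_pmul2l (_ : 0 < 4)) //; apply: leq_trans cAj.
    have hD : 16 * (q * t + t + 1) * (n %/ D) <= n.
      apply: leq_trans (leq_trunc_div n D); rewrite mulnC leq_mul2l /D.
      by apply/orP; right; apply: leq_pmull.
    move: (n %/ D) hD => b hD; have : a * b <= t * b by rewrite leq_mul2r; lia.
    move: (c) cn cmn hD => c' cn cmn hD; lia.
  have [|I' II cI'] := @subset_card G (n %/ (4 * t)) I.
    rewrite -ltnS ltn_divLR; last by lia.
    have : a * #|I| <= t * #|I| by rewrite leq_mul2r; lia.
    lia.
  by exists I'; rewrite (subset_trans II IA) cI' eqxx (indepS II iI).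
pose A' i := odflt set0 [pick I : {set G} | [&& I \subset A i, #|I| == n %/ (4 * t) & indep I]].
have A'P i : i < q -> [/\ A' i \subset A i, #|A' i| = n %/ (4 * t) & indep (A' i)].
  move=> iq; rewrite /A'; case: pickP => [I /and3P[-> /eqP -> ->]//|h].
  by have [I] := iA i iq; rewrite h.
exists A'; split=> [i j iq jq ij u uA|i /A'P[] //].
have [sAi _ _] := A'P i iq; have [sAj _ _] := A'P j jq.
apply: leq_trans (leq_trans (AD i j iq jq ij u (subsetP sAi u uA)) _).
  by apply/subset_leq_card/setSD.
by apply: leq_div2l; rewrite /D //; apply: leq_pmulr; lia.
Qed.

Lemma card_star_free_lt k q t : 0 < k -> 0 < t -> 1 < q ->
  exists c, forall (G : sgraph) n m a, c <= n -> c * m <= n -> 0 < a <= t ->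
  small_books G k n -> star_free G q a t m ->
  #|G| <> q * n.-1 + k * q * a.-1 + 1.
Proof.
move=> k0 t0 q1.
(* [L] will bound ['C(alpha, k) / 'C(g, k)]; [Q] makes [P], which dominates the error terms, small
   compared with [alpha / L]. *)
have [L EL] : exists L, L = (4 * t) ^ k by exists ((4 * t) ^ k).
have [Q EQ] : exists Q, Q = 16 * t * L * k.+1 by eexists.
have [B EB] : exists B, B = 4 * Q * (q * t + 1) by eexists.
have L0 : 0 < L by rewrite EL expn_gt0 muln_gt0 t0.
have tL : 4 * t <= L by rewrite EL -{1}(expn1 (4 * t)) leq_exp2l //; lia.
have Q0 : 0 < Q by rewrite EQ !muln_gt0 t0 L0.
have [|c ip] := @independent_parts k q t B t0 q1; first by rewrite EB addn1 muln_gt0 (muln_gt0 4) Q0.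
exists (c + 4 * Q * (t + k) + 4 * Q + k * t + 1) => G n m a cn cmn at0 sb sf cG.
have [aP aT] := andP at0.
have [|||A [AD cA]] := ip G n m a _ _ at0 sb sf.
- by apply: leq_trans cn; rewrite -!addnA leq_addr.
- by apply: leq_trans cmn; rewrite leq_mul2r -!addnA leq_addr orbT.
  rewrite cG -addnA leq_addr /=.
  have : q * (k * a.-1 + 1) <= q * n.
    rewrite leq_mul2l; apply/orP; right.
    have : k * a.-1 <= k * t by rewrite leq_mul2l (leq_trans (leq_pred a)) ?orbT.
    by move: cn; clear; lia.
  have : q * n.-1 <= q * n by rewrite leq_mul2l leq_pred orbT.
  by move: q1; clear; lia.
have [alpha Ea] : exists x, x = n %/ (4 * t) by eexists.
have [b Eb] : exists x, x = n %/ B by eexists.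
have [h Eh] : exists x, x = q * (t * b) + t + m by eexists.
have [P EP] : exists x, x = (q * t + 1) * b + t + m + k by eexists.
rewrite -Eb in AD; have {}cA i : i < q -> #|A i| = alpha /\ indep (A i) by rewrite Ea; apply: cA.
have QP : Q * P <= n.
  have h1 : 4 * Q * (q * t + 1) * b <= n by rewrite Eb EB mulnC; apply: leq_trunc_div.
  have h2 : 4 * Q * m <= n by apply: leq_trans cmn; rewrite leq_mul2r; apply/orP; right; clear; lia.
  have h3 : 4 * Q * (t + k) <= n by apply: leq_trans cn; clear; lia.
  by rewrite EP; move: h1 h2 h3; clear; lia.
have aP4 : 4 * (L * k.+1 * P) <= alpha.
  rewrite Ea leq_divRL; last by lia.
  by apply: leq_trans QP; rewrite EQ; clear; lia.
have hP : h + b + k <= P by rewrite Eh EP; clear; lia.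
have P0 : 0 < P by rewrite EP; clear -k0; lia.
have PkL : P <= L * k.+1 * P by rewrite leq_pmull // muln_gt0 L0.
(* With this [g], [a] vertices that each miss at most [g] vertices of some [A j] still have half of
   it as common neighbours. *)
have [g Eg] : exists x, x = alpha %/ (2 * t) by eexists.
have tg : 2 * (t * g) <= alpha by rewrite Eg mulnA mulnC; apply: leq_trunc_div.
have starA : b + a * g + h <= alpha.
  have : a * g <= t * g by rewrite leq_mul2r aT orbT.
  by move: PkL aP4 hP tg; clear; lia.
pose M := 'C(alpha, k); have M0 : 0 < M by rewrite bin_gt0; move: PkL aP4 hP; clear; lia.
(* The first binomial falls short of [M] by at most a fraction [1 / L], and the second is at least
   that much. *)
have hM : M <= 'C(alpha - h, k) + 'C(g, k).
  rewrite -(leq_pmul2l L0) mulnDr.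
  have e1 : M <= L * 'C(g, k).
    have -> : L = (2 * (2 * t)) ^ k by rewrite EL mulnA.
    rewrite Eg; apply: bin_divn_ratio; first by rewrite muln_gt0 t0.
    have : 4 * t * k.+1 * 1 <= L * k.+1 * P by rewrite leq_mul // leq_mul2r tL orbT.
    by move: aP4; clear; lia.
  have e2 : L.-1 * M <= L * 'C(alpha - h, k).
    have := @bin_sub_ratio k L.-1 alpha h; rewrite prednK //; apply.
    have : L * k * (h + k) <= L * k.+1 * P.
      by apply: leq_mul; [rewrite leq_mul2l leqnSn orbT|move: hP; clear; lia].
    by move: aP4; clear; lia.
  rewrite -[L in L * M](prednK L0) mulSn.
  by move: e1 e2; clear; lia.
have ex_f v : [exists i : 'I_q, #|A i :&: nbr v| < h].
  apply: contraT; rewrite negb_exists => /forallP hv; exfalso.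
  apply: (no_common_vertex (v := v) AD sf q1 aT) => i iq; rewrite -Eh.
  by have := hv (Ordinal iq); rewrite -leqNgt.
pose f v := odflt (Ordinal (ltnW q1)) [pick i : 'I_q | #|A i :&: nbr v| < h].
have fP v : #|A (f v) :&: nbr v| < h.
  rewrite /f; case: pickP => [//|hv].
  by have /existsP[i] := ex_f v; rewrite hv.
pose irr v := [exists j : 'I_q, (j != f v) && (g <= #|A j :\: nbr v|)].
pose d (j : 'I_q) v := 'C(#|A j :\: nbr v|, k).
have irr_d v : irr v -> M <= \sum_j d j v.
  move=> /existsP[j /andP[jf hj]].
  rewrite (bigD1 (f v)) //= (bigD1 j) //=.
  apply: (leq_trans hM); rewrite addnA; apply: leq_trans (leq_addr _ _).
  apply: leq_add; last exact: leq_bin2l.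
  apply: leq_bin2l; have := cardsID (nbr v) (A (f v)); have := fP v.
  by have [-> _] := cA (f v) (ltn_ord _); clear; lia.
pose Reg j := [set v | (f v == j) && ~~ irr v].
(* A vertex of [A j] with [a] neighbours in [Reg j] would contradict [no_star]; hence [sum_bin_ge]
   applies with [d = a.-1]. *)
have Reg_d j : M * #|Reg j| <= \sum_(v in Reg j) d j v + M * (k * a.-1).
  have [cAj _] := cA j (ltn_ord j).
  rewrite /M -cAj; apply: sum_bin_ge => u uA.
  rewrite -ltnS prednK // ltnNge; apply/negP => /subset_card[S SR cS].
  move: SR; rewrite subsetI => /andP[SR Su].
  apply: (no_star AD sf q1 (ltn_ord j) uA Su cS (g := g)); last first.
    by move=> l lq lj; have [-> _] := cA l lq; rewrite -Eh.
  move=> l lq lj w wS; have := subsetP SR w wS; rewrite inE => /andP[/eqP fw].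
  rewrite negb_exists => /forallP/(_ (Ordinal lq)); rewrite fw negb_and negbK.
  by rewrite -(inj_eq val_inj) /= (negPf lj) /= -ltnNge => /ltnW.
have up : \sum_v \sum_j d j v <= q * (M * n.-1).
  rewrite exchange_big /= -[X in _ <= X * _](card_ord q) -sum_nat_const.
  apply: leq_sum => j _; have [cAj iA] := cA j (ltn_ord j).
  by have := sum_bin_le sb iA; rewrite cAj.
have cReg : #|G| = #|[set v | irr v]| + \sum_j #|Reg j|.
  rewrite -cardsT -(cardsID [set v | irr v]) setTI; congr (_ + _).
  rewrite -sum1_card (partition_big f predT) //=; apply: eq_bigr => j _.
  by rewrite -sum1_card; apply: eq_bigl => v; rewrite !inE andbT andbC.
have low : M * #|G| <= \sum_v \sum_j d j v + q * (M * (k * a.-1)).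
  have -> : \sum_v \sum_j d j v =
      \sum_(v | irr v) \sum_j d j v + \sum_(v | ~~ irr v) \sum_j d j v.
    by rewrite (bigID irr).
  rewrite cReg mulnDr -addnA; apply: leq_add.
    rewrite mulnC -sum_nat_const; apply: (@leq_trans (\sum_(v | irr v) M)).
      by apply: eq_leq; apply: eq_bigl => v; rewrite inE.
    by apply: leq_sum => v /irr_d.
  rewrite (partition_big f predT) //=.
  have -> : q * (M * (k * a.-1)) = \sum_(j < q) M * (k * a.-1).
    by rewrite sum_nat_const card_ord.
  rewrite -big_split big_distrr /=.
  apply: leq_sum => j _; apply: (leq_trans (Reg_d j)); rewrite leq_add2r.
  rewrite (eq_bigl (fun v => ~~ irr v && (f v == j))) => [|v]; last first.
    by rewrite inE andbC.
  by apply: leq_sum => v _; rewrite (bigD1 j) //= leq_addr.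
have : M * #|G| <= M * (q * n.-1 + q * (k * a.-1)).
  by apply: (leq_trans low); rewrite mulnDr leq_add ?(leq_trans up) // mulnCA.
by rewrite leq_pmul2l // cG; clear; lia.
Qed.

(** Settles the case of two parts. As [k * a <= n], a greedy choice finds an independent [k]-set;
    fewer than [n] vertices have no neighbour in it, and at most [k * a.-1] have one. *)
Lemma card_bounded_degree_lt (G : sgraph) k n a : 0 < a -> k * a <= n ->
  small_books G k n -> (forall v : G, #|nbr v| < a) ->
  #|G| <= n.-1 + k * a.-1.
Proof.
move=> a0 kan sb deg; rewrite leqNgt; apply/negP => big.
have [v _|I [_ iI cI]] := @indep_greedy G a setT; first by rewrite setIT.
rewrite cardsT in cI.
have [|J JI cJ] := @subset_card G k I.
  by rewrite -(leq_pmul2l a0); move: kan cI big; rewrite mulnC; lia.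
have iJ := indepS JI iI.
have := sum_bin_le sb iJ; rewrite cJ binn mul1n => h.
have := @sum_bin_ge G k a.-1 J setT; rewrite cJ binn !mul1n cardsT.
rewrite (eq_bigl predT) => [|v]; last by rewrite inE.
move=> h2; have : #|G| <= n.-1 + k * a.-1; last by lia.
apply: leq_trans (h2 _) _; last by rewrite leq_add2r.
by move=> u _; rewrite setTI -ltnS prednK.
Qed.

(** * Embeddings and the lower bound *)

Lemma joined_multipartite (G : sgraph) p (a : 'I_p -> nat) (l : seq {set G}) :
  size l = p -> pairwise (@joined G) l ->
  (forall i : 'I_p, a i <= #|nth set0 l i|) ->
  has_subgraph G (complete_multipartite a).
Proof.
move=> sl jl la.
have jn (i j : 'I_p) : i != j -> joined (nth set0 l i) (nth set0 l j).
  have lt_jn (x y : 'I_p) : x < y -> joined (nth set0 l x) (nth set0 l y).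
    by move=> xy; apply: (pairwiseP set0 jl); rewrite ?inE ?sl.
  rewrite -(inj_eq val_inj) /= neq_ltn => /orP[] /lt_jn //.
  by rewrite joined_sym.
pose f (x : complete_multipartite a) : G :=
  enum_val (widen_ord (la (tag x)) (tagged x)).
have fadj x y : adj x y -> adj (f x) (f y).
  move=> /jn /joinedP; apply; exact: enum_valP.
exists f; split=> // x y fxy.
have [/eqP|xy] := boolP (tag x == tag y); last first.
  by have := fadj x y xy; rewrite fxy adj_irr.
case: x y fxy => [i x] [j y] + /= ij; case: j / ij y => y.
by move=> /enum_val_inj /(congr1 val) /= xy; congr existT; apply: val_inj.
Qed.

(** The book is placed along the list of [I] followed by the rest of [nonnbr I], so indices below
    [k] go to the spine [I]. *)
Lemma no_book_small (G : sgraph) k n :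
  ~ has_subgraph (compl G) (book k n) -> small_books G k n.
Proof.
move=> nb I iI cI; rewrite ltnNge; apply/negP => nI; apply: nb.
have IN : I \subset nonnbr I.
  apply/subsetP => x xI; rewrite inE; apply/subsetP => y yI.
  by rewrite inE in_nbr; move/indepP: iI; apply.
pose l := enum I ++ enum (nonnbr I :\: I).
have sl : n <= size l.
  by rewrite size_cat -!cardE; have := cardsID I (nonnbr I); rewrite (setIidPr IN) => ->.
have ul : uniq l.
  rewrite cat_uniq !enum_uniq andbT /=; apply/hasPn => x.
  by rewrite !mem_enum inE => /andP[].
pose f (x : book k n) : G := tnth (in_tuple l) (widen_ord sl x).
have fN x : f x \in nonnbr I.
  have := mem_tnth (widen_ord sl x) (in_tuple l); rewrite mem_cat !mem_enum.
  by case/orP => [/(subsetP IN)|]; rewrite // inE => /andP[].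
have fI (x : book k n) : x < k -> f x \in I.
  move=> xk; rewrite /f (tnth_nth (f x)) /= nth_cat -cardE cI xk.
  by rewrite -mem_enum mem_nth // -cardE cI.
have fK (x y : book k n) : x < k -> ~~ adj (f x) (f y).
  move=> /fI xI; have := fN y; rewrite inE => /subsetP/(_ _ xI).
  by rewrite inE in_nbr adj_sym.
have f_inj : injective f.
  move=> x y; rewrite /f !(tnth_nth (f x)) /= => /eqP.
  by rewrite nth_uniq ?(leq_trans (ltn_ord _) sl) // => /eqP /val_inj.
exists f; split=> // x y /andP[xy /orP[xk|yk]];
  rewrite /= /compl_adj (inj_eq f_inj) xy /=; first exact: fK.
by rewrite adj_sym; apply: fK.
Qed.

Lemma ramsey_prop_le (H1 H2 : sgraph) r (G : sgraph) :
  ramsey_prop H1 H2 r -> r <= #|G| ->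
  has_subgraph G H1 \/ has_subgraph (compl G) H2.
Proof.
move=> rp rG; pose g (i : 'I_r) : G := enum_val (widen_ord rG i).
have g_inj : injective g.
  by move=> i j /enum_val_inj /(congr1 val) /= ij; apply: val_inj.
pose e : rel 'I_r := fun i j => adj (g i) (g j).
have e_sym : symmetric e by move=> i j; apply: adj_sym.
have e_irr : irreflexive e by move=> i; apply: adj_irr.
have [|[f [f_inj fe]]|[f [f_inj fe]]] := rp (SGraph e_sym e_irr).
- exact: card_ord.
- by left; exists (g \o f); split=> [|x y /fe //]; apply: inj_comp.
right; exists (g \o f); split=> [|x y /fe]; first exact: inj_comp.
by rewrite /= /compl_adj /= (inj_eq g_inj).
Qed.

(** * The extremal graph, with coordinates block, clique and place in the clique *)

Section LowerBound.
Variables q c a : nat.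

Definition block_adj : rel ('I_q * 'I_c * 'I_a) :=
  fun x y => (x != y) && ((x.1.1 != y.1.1) || (x.1.2 == y.1.2)).

Lemma block_adj_sym : symmetric block_adj.
Proof.
by move=> x y; rewrite /block_adj eq_sym (eq_sym x.1.1) (eq_sym x.1.2).
Qed.

Lemma block_adj_irr : irreflexive block_adj.
Proof. by move=> x; rewrite /block_adj eqxx. Qed.

Definition block_graph := SGraph block_adj_sym block_adj_irr.

Lemma card_block_graph : #|block_graph| = q * (c * a).
Proof. by rewrite !card_prod !card_ord mulnA. Qed.

(* The parts may be truncated to sizes 1, a, ..., a; then some block receives
   more than a vertices, which lie in several parts, so in a common clique. *)
Lemma block_graph_multipartite (b : 'I_q.+1 -> nat) : 0 < a -> 0 < b ord0 ->
  (forall i, i != ord0 -> a <= b i) ->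
  ~ has_subgraph block_graph (complete_multipartite b).
Proof.
move=> a0 b0 ba [f [f_inj fadj]].
pose d (i : 'I_q.+1) := if i == ord0 then 1 else a.
have db i : d i <= b i by rewrite /d; case: eqVneq => [->|/ba].
have da i : d i <= a by rewrite /d; case: ifP.
pose emb (x : complete_multipartite d) : complete_multipartite b :=
  Tagged (fun i => 'I_(b i)) (widen_ord (db (tag x)) (tagged x)).
have emb_inj : injective emb.
  move=> [i x] [j y] /= E; have ij : i = j by have := congr1 tag E.
  case: j / ij y E => y /eqP; rewrite eq_Tagged /= => /eqP /(congr1 val) /= xy.
  by congr existT; apply: val_inj.
pose F x := f (emb x).
have F_inj : injective F by apply: inj_comp.
have F_adj x y : tag x != tag y -> adj (F x) (F y).
  by move=> xy; apply: fadj.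
pose S s := [set x | (F x).1.1 == s].
have cS s : #|S s| <= a.
  (* Adjacent vertices of one block share a clique. If two parts meet the block, all of [S s] is
     mapped into one clique of size [a]; otherwise [S s] lies in one part of size at most [a]. *)
  have [/existsP[x /existsP[y /and3P[xS yS xy]]]|one] :=
      boolP [exists x, exists y, [&& x \in S s, y \in S s & tag x != tag y]].
    have clique z w : z \in S s -> w \in S s -> tag z != tag w ->
        (F z).1.2 = (F w).1.2.
      rewrite !inE => /eqP zs /eqP ws /F_adj /andP[_].
      by rewrite zs ws eqxx /= => /eqP.
    have all_clique z : z \in S s -> (F z).1.2 = (F x).1.2.
      move=> zS; have [zx|zx] := eqVneq (tag z) (tag x); last exact: clique.
      by rewrite (clique x y) //; apply: clique; rewrite // zx.
    rewrite -[leqRHS]card_ord -(card_in_imset (f := fun z => (F z).2)).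
      exact: max_card.
    move=> z w zS wS zw; apply: F_inj.
    move: (zS) (wS) zw (all_clique z zS) (all_clique w wS); rewrite !inE.
    case: (F z) (F w) => [[z1 z2] z3] [[w1 w2] w3] /=.
    by move=> /eqP -> /eqP -> -> -> ->.
  rewrite -[leqRHS]card_ord -(card_in_imset (f := fun z => widen_ord (da (tag z)) (tagged z))).
    exact: max_card.
  move=> z w zS wS /(congr1 val) /= zw.
  have tzw : tag z = tag w.
    apply/eqP; move: one; rewrite negb_exists => /forallP/(_ z).
    rewrite negb_exists => /forallP/(_ w); by rewrite zS wS negbK.
  case: z w {zS wS} tzw zw => [i z] [j w] /= ij; case: j / ij w => w zw.
  by congr existT; apply: val_inj.
have : #|complete_multipartite d| <= q * a.
  rewrite -cardsT -sum1_card (partition_big (fun x => (F x).1.1) predT) //=.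
  rewrite -[q in q * a]card_ord -sum_nat_const; apply: leq_sum => s _.
  apply: leq_trans (cS s); rewrite -sum1_card.
  by apply: eq_leq; apply: eq_bigl => x; rewrite !inE.
rewrite card_tagged sumnE big_map big_enum /= big_ord_recl card_ord.
rewrite (eq_bigr (fun=> a)) => [|i _]; last by rewrite card_ord.
by rewrite sum_nat_const card_ord /d eqxx ltnn.
Qed.

(** In the complement the spine meets [k] different cliques of one block. The other [n - k] vertices
    stay in that block and avoid these cliques, which would need [n - k + k * a <= c * a]. *)
Lemma block_graph_book k n : 0 < k -> k < n -> c * a < n - k + k * a ->
  ~ has_subgraph (compl block_graph) (book k n).
Proof.
move=> k0 kn ca [f [f_inj fadj]].
have f_eq (x y : 'I_n) : x < k -> x != y ->
    (f x).1.1 = (f y).1.1 /\ (f x).1.2 != (f y).1.2.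
  move=> xk xy; have /fadj : adj (x : book k n) y by rewrite /= /book_adj xy xk.
  rewrite /= /compl_adj /= /block_adj (inj_eq f_inj) xy /= negb_or negbK.
  by case/andP => /eqP.
pose x0 : 'I_n := Ordinal (ltn_trans k0 kn).
have block y : (f y).1.1 = (f x0).1.1.
  by have [->//|y0] := eqVneq y x0; have [] := f_eq x0 y k0; rewrite // eq_sym.
pose low := [set x : 'I_n | x < k].
have clow : #|low| = k.
  have <- : #|[set widen_ord (ltnW kn) i | i : 'I_k]| = k.
    by rewrite card_imset ?card_ord // => i j /(congr1 val) /= /val_inj.
  apply: eq_card => x; rewrite inE; apply/idP/imsetP => [xk|[i _ ->]].
    by exists (Ordinal xk) => //; apply: val_inj.
  by rewrite /= ltn_ord.
pose C := (fun x => (f x).1.2) @: low.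
have cC : #|C| = k.
  rewrite card_in_imset // => x y; rewrite !inE => xk yk xy.
  by apply/eqP; apply: contraT => /(f_eq x y xk)[_]; rewrite xy eqxx.
pose B := (fun y => ((f y).1.2, (f y).2)) @: ~: low.
have cB : #|B| = n - k.
  have := cardsC low; rewrite clow card_ord => h.
  have {}h : #|~: low| = n - k by rewrite -(addKn k #|~: low|) h.
  rewrite card_imset //.
  move=> x y [E1 E2]; apply: f_inj; move: E1 E2 (block x) (block y).
  by case: (f x) (f y) => [[x1 x2] x3] [[y1 y2] y3] /= -> -> -> ->.
have dis : [disjoint B & setX C [set: 'I_a]].
  rewrite -setI_eq0; apply/eqP/setP => w; rewrite !inE andbT; apply/negP.
  move=> /andP[/imsetP[y +] ->]; rewrite !inE /= => yk /imsetP[x]; rewrite inE => xk.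
  have [|_ /eqP h] := f_eq x y xk; last by move=> E; apply: h.
  by apply: contraNneq yk => <-.
have := max_card (mem (B :|: setX C [set: 'I_a])).
have := leq_card_setU B (setX C [set: 'I_a]); rewrite dis => -[_ /eqP] ->.
rewrite cardsX cB cC cardsT card_prod !card_ord.
by rewrite leqNgt ca.
Qed.
End LowerBound.

(** * The Ramsey number from the two bounds *)

Import GRing.Theory Num.Theory.

Theorem theorem1p4 (R : realType) (k p t : nat)
    (hk : 2 <= k) (hp : 2 <= p) (ht : 2 <= t) :
  exists delta : R, (0 < delta)%R /\
  exists n0 : nat, forall n : nat, n0 <= n ->
  forall a : nat -> nat,
    (forall i, 1 <= i <= p -> 1 <= a i) ->
    (forall i j, 1 <= i -> i <= j -> j <= p - 1 -> a i <= a j) ->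
    a (p - 1) <= t ->
    ((a p)%:R <= delta * n%:R)%R ->
    a 1 = 1 ->
    let r := ramsey (complete_multipartite (fun i : 'I_p => a i.+1)) (book k n) in
    let m := (p - 1) * (n - 1) + k * (p - 1) * (a 2 - 1) + 1 in
    r <= m /\ (a 2 %| n - 1 - k -> a (p - 1) <= a p -> r = m).
Proof.
have [q Eq] : exists q, p = q.+1 by exists p.-1; lia.
move: hp; rewrite {p}Eq ltnS => q0.
have upper : exists c, forall (G : sgraph) n a, c <= n -> c * a q.+1 <= n ->
    (forall i, 1 <= i <= q.+1 -> 1 <= a i) ->
    (forall i j, 1 <= i -> i <= j -> j <= q -> a i <= a j) ->
    a q <= t -> a 1 = 1 -> #|G| = q * (n - 1) + k * q * (a 2 - 1) + 1 ->
    has_subgraph G (complete_multipartite (fun i : 'I_q.+1 => a i.+1)) \/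
    has_subgraph (compl G) (book k n).
  (* For [q = 1] the first graph is the star with [a 2] leaves, and its absence bounds all
     degrees. *)
  have [q1|q1] := leqP q 1.
    have {q0 q1}-> : q = 1 by lia.
    exists k => G n a kn kan a_gt0 _ _ a1 cG.
    have [|nb] := pselect (has_subgraph (compl G) (book k n)); first by right.
    left; have [/existsP[v hv]|] := boolP [exists v : G, a 2 <= #|nbr v|].
      apply: (@joined_multipartite _ _ _ [:: [set v]; nbr v]) => //=.
        by rewrite !andbT; apply/joinedP => x y /set1P ->; rewrite in_nbr.
      case=> [[|[|//]] lti] //=; by rewrite cards1 a1.
    rewrite negb_exists => /forallP deg.
    have lt_deg (v : G) : #|nbr v| < a 2 by rewrite ltnNge; apply: deg.
    have := card_bounded_degree_lt (a_gt0 2 isT) kan (no_book_small nb) lt_deg.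
    by rewrite cG; lia.
  have [||c hc] := @card_star_free_lt k q t _ _ q1; try lia.
  exists c => G n a cn can a_gt0 a_mono aqt a1 cG.
  have [|nb] := pselect (has_subgraph (compl G) (book k n)); first by right.
  left; apply: contrapT => nK.
  apply: (hc G n (a q.+1) (a 2) cn can _ (no_book_small nb)).
  - by rewrite a_gt0 // (leq_trans _ aqt) //; apply: a_mono.
  - move=> v B L X sL jL aB tL; rewrite ltnNge; apply/negP => aX; apply: nK.
    apply: (joined_multipartite _ jL); first by rewrite /= size_rcons sL.
    case=> [[|[|i]] lti] //=; first by rewrite cards1 a1.
    rewrite nth_rcons; case: ltngtP => iL.
    + apply: (@leq_trans t); last by apply: (allP tL); apply: mem_nth.
      by apply: leq_trans aqt; apply: a_mono; lia.
    + by move: lti; rewrite -sL; lia.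
    + by rewrite iL sL.
  - by rewrite cG !subn1.
have [c hc] := upper.
exists (c.+1%:R^-1)%R; split; first by rewrite invr_gt0 ltr0Sn.
exists (c + k + 2) => n nbig a a_gt0 a_mono aqt adelta a1 r m.
rewrite subn1 /= in a_mono aqt *.
have can : c.+1 * a q.+1 <= n.
  by move: adelta; rewrite mulrC ler_pdivlMr ?ltr0Sn // -natrM ler_nat mulnC.
have a2 : 0 < a 2 by apply: a_gt0.
have Em : m = q * (n - 1) + k * q * (a 2 - 1) + 1 by rewrite /m subn1.
have rm : r <= m.
  rewrite /r /ramsey; case: ex_minnP => x _; apply.
  rewrite Em addn1 /=; apply/asboolP => G cG; apply: hc => //; first by lia.
    by apply: leq_trans can; rewrite leq_mul2r leqnSn orbT.
  by rewrite cG addn1.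
split=> // adiv aqp; apply/eqP; rewrite eqn_leq rm leqNgt; apply/negP => rltm.
have [d Ed] := dvdnP adiv.
(* As [n - 1 - k = d * a 2], blocks of [d + k] cliques have the largest order that
   [block_graph_book] allows, and [q] of them give [m - 1] vertices. *)
have ca : (d + k) * a 2 = n - 1 + k * (a 2 - 1).
  have e : k * a 2 = k * (a 2 - 1) + k by rewrite -mulnSr subn1 prednK.
  rewrite mulnDl -Ed e; lia.
have r_prop : ramsey_prop (complete_multipartite (fun i : 'I_q.+1 => a i.+1)) (book k n) r.
  by rewrite /r /ramsey; case: ex_minnP => x /andP[_ /asboolP].
have [||] := @ramsey_prop_le _ _ _ (block_graph q (d + k) (a 2)) r_prop.
- rewrite card_block_graph ca -ltnS (leq_trans rltm) // Em; lia.
- apply: block_graph_multipartite => //=; first by rewrite a1.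
  move=> i; rewrite -(inj_eq val_inj) /= => i0.
  (* For [q = 1] the hypothesis [aqp] only compares [a 1] with [a 2], but [a 2] is then the last
     part itself. *)
  have aq : a 2 <= a q.+1.
    have [q1|q1] := leqP q 1; last by apply: leq_trans aqp; apply: a_mono.
    by have -> : q = 1 by lia.
  have [->//|iq] := eqVneq (i : nat) q.
  by have := ltn_ord i; apply: (fun h => a_mono 2 i.+1 isT _ _) => //; lia.
- by apply: block_graph_book; lia.
Qed.
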